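(* Let $0<\alpha\le 2$ and distinguish the cases (i) $0<\alpha<2$ and (ii) $\alpha=2$. In case (i), let $b(\alpha)=\frac{1}{\pi}\Gamma(\alpha+1)\sin(\alpha\pi/2)$, let $\mu$ be a real number with $$0<\mu\le\frac{1}{2\,b(\alpha)\,\zeta(\alpha+1)},$$ and define $$p_0=1-2\mu\, b(\alpha)\,\zeta(\alpha+1),\qquad p_k=\mu\, b(\alpha)\,|k|^{-(\alpha+1)}\quad(k\in\mathbb{Z},\ k\neq0).$$ In case (ii), let $\lambda$ be a real number with $0<\lambda\le\frac{1}{2\zeta(3)}$ and define $$p_0=1-2\lambda\zeta(3),\qquad p_k=\lambda|k|^{-3}\quad(k\in\mathbb{Z},\ k\neq 0).$$ Let $Y_1,Y_2,\dots$ be independent identically distributed $\mathbb{Z}$-valued random variables with $P(Y_m=k)=p_k$ for all $k\in\mathbb{Z}$. Let the scaling function be $$\sigma(h)=\mu h^\alpha\ \text{ in case (i)},\qquad \sigma(h)=\lambda h^2\log\frac1h\ \text{ in case (ii)}.$$ Fix $t>0$. Let $(h_n)$ be a sequence, defined for all sufficiently large $n\in\mathbb{N}$, with $h_n>0$ (and $h_n<1$ in case (ii)), $\sigma(h_n)=\tau=t/n$, and $h_n\to0$ as $n\to\infty$. Put $$S_n=h_n\sum_{m=1}^nY_m.$$ Then, as $n\to\infty$, $S_n$ converges in distribution to the random variable $S(t)$ whose probability density is $g_\alpha(\cdot,t;0)$.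
   Context: For $0<\alpha\le 2$ and $t>0$, $g_\alpha(x,t;0)=\frac{1}{2\pi}\int_{-\infty}^{+\infty}e^{-i\kappa x}\exp(-t|\kappa|^\alpha)\,d\kappa$ ($x\in\mathbb{R}$) is the symmetric stable probability density with characteristic function $\int_{-\infty}^{+\infty}e^{i\kappa x}g_\alpha(x,t;0)\,dx=\exp(-t|\kappa|^\alpha)$, $\kappa\in\mathbb{R}$. $S(t)$ denotes a random variable with this density. $\zeta(z)=\sum_{k=1}^\infty k^{-z}$ (for $\Re z>1$) is the Riemann zeta function and $\Gamma$ is the gamma function. *)

(* Defs.v *)
From HB Require Import structures.
From mathcomp Require Import all_boot all_order all_algebra.
From mathcomp Require Import finmap.
From mathcomp Require Import all_classical all_reals all_analysis measurable_realfun.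
From mathcomp Require Import complex.

Set Implicit Arguments.
Unset Strict Implicit.
Unset Printing Implicit Defensive.

Import Order.TTheory GRing.Theory Num.Theory.
Import numFieldNormedType.Exports.

Local Open Scope classical_set_scope.
Local Open Scope ring_scope.

HB.instance Definition _ := isPointed.Build int 0.

(* The library equips nat, but not int, with the discrete sigma-algebra. *)
HB.instance Definition _ := @isMeasurable.Build default_measure_display
  int (@discrete_measurable int) (@discrete_measurable0 int)
  (@discrete_measurableC int) (@discrete_measurableU int).

Section special_functions.
Context {R : realType}.

(* Meaningful for 0 < z. *)
Definition Gamma (z : R) : R :=
  \int[lebesgue_measure]_(x in `]0, +oo[) (x `^ (z - 1) * expR (- x)).

(* Meaningful for 1 < z; only real arguments are needed. The series is indexed
   from 0, whence the shift. *)
Definition zeta (z : R) : R := limn (series (fun k => k.+1%:R `^ (- z))).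

End special_functions.

Section stable_density.
Context {R : realType}.
Local Open Scope complex_scope.

(* e^(i x) *)
Definition expi (x : R) : R[i] := cos x +i* sin x.

(* The library integrates only real-valued functions; complex-valued ones are
   integrated componentwise. *)
Definition Cintegral (f : R -> R[i]) : R[i] :=
  (\int[lebesgue_measure]_x complex.Re (f x)) +i* (\int[lebesgue_measure]_x complex.Im (f x)).

Definition g_stable (alpha t x : R) : R[i] :=
  (2 * pi)^-1%:C *
  Cintegral (fun k => expi (- (k * x)) * (expR (- (t * `|k| `^ alpha)))%:C).

(* g_stable is real-valued, see g_stable_real. *)
Definition stable_density (alpha t x : R) : R := complex.Re (g_stable alpha t x).

Let Rintegral_odd (f : R -> R) : measurable_fun setT f ->
  (forall x, f (- x) = - f x) -> \int[lebesgue_measure]_x f x = 0.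
Proof.
move=> mf oddf; rewrite /Rintegral integralE.
set a := (\int[_]_x (_ ^\+ x))%E; set b := (\int[_]_x (_ ^\- x))%E.
suff -> : a = b by case: b => [r| |] //=; rewrite subrr.
transitivity (\int[pushforward lebesgue_measure (-%R : R -> measurableTypeR R)]_x
  ((EFin \o f)^\+ x))%E.
  by apply: eq_measure_integral => A mA _; exact/esym/lebesgue_measureN.
rewrite ge0_integral_pushforward//; last first.
  by apply: measurable_funepos; exact/measurable_EFinP.
apply: eq_integral => x _ /=.
by rewrite funeposE funenegE /= oddf.
Qed.

Lemma g_stable_real alpha t x :
  g_stable alpha t x = (stable_density alpha t x)%:C.
Proof.
rewrite /stable_density /g_stable; set I := Cintegral _.
suff -> : I = (complex.Re I)%:C by rewrite -rmorphM.
rewrite /I /Cintegral /=; congr (_ +i* _).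
apply: Rintegral_odd => [|k].
  have mkx : measurable_fun [set: R] (fun k => - (k * x)).
    by apply: measurableT_comp => //; exact: measurable_funM.
  apply: measurable_funD; apply: measurable_funM => //.
  - apply: (measurableT_comp _ mkx).
    by apply: continuous_measurable_fun; exact: continuous_cos.
  - apply: (measurableT_comp _ mkx).
    by apply: continuous_measurable_fun; exact: continuous_sin.
  - apply: measurableT_comp => //; apply: measurableT_comp => //.
    apply: measurable_funM => //.
    by apply: (@measurableT_comp _ _ _ _ _ _ (fun y : R => y `^ alpha)) => //.
by rewrite !mulr0 !add0r normrN !mulNr opprK sinN mulNr opprK.
Qed.

End stable_density.

Section probability_notions.
Context {R : realType}.

Definition mutually_independent d (T : measurableType d) (P : probability T R)
    d' (T' : measurableType d') (Y : nat -> {RV P >-> T'}) :=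
  forall (J : {fset nat}) (A : nat -> set T'), (forall j, measurable (A j)) ->
  P (\bigcap_(j in [set` J]) (Y j @^-1` A j)) =
  (\prod_(j <- J) P (Y j @^-1` A j))%E.

Definition has_density d (T : measurableType d) (P : probability T R)
    (X : {RV P >-> R}) (f : R -> R) :=
  forall A : set R, measurable A ->
  distribution P X A = (\int[lebesgue_measure]_(x in A) (f x)%:E)%E.

Definition converges_in_distribution
    d (T : measurableType d) (P : probability T R) (X : nat -> {RV P >-> R})
    d' (T' : measurableType d') (P' : probability T' R) (Z : {RV P' >-> R}) :=
  forall x, {for x, continuous (cdf Z)} -> cdf (X n) x @[n --> \oo] --> cdf Z x.

End probability_notions.

Section random_walk.
Context {R : realType}.

Definition b_coef (alpha : R) : R :=
  pi^-1 * Gamma (alpha + 1) * sin (alpha * pi / 2).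

Definition step_prob_lt2 (alpha mu : R) (k : int) : R :=
  if k == 0 then 1 - 2 * mu * b_coef alpha * zeta (alpha + 1)
  else mu * b_coef alpha * `|k|%:~R `^ (- (alpha + 1)).

Definition step_prob_eq2 (lambda : R) (k : int) : R :=
  if k == 0 then 1 - 2 * lambda * zeta 3 else lambda * `|k|%:~R ^- 3.

Definition scaling_lt2 (alpha mu h : R) : R := mu * h `^ alpha.

Definition scaling_eq2 (lambda h : R) : R := lambda * h ^+ 2 * ln h^-1.

Context d (T : measurableType d) (P : probability T R).
Context (Y : nat -> {RV P >-> int}) (h : nat -> R).

(* Y is indexed from 0, so Y m stands for the (m+1)-st step. *)
Definition walk (n : nat) (w : T) : R := h n * \sum_(m < n) (Y m w)%:~R.

Let measurable_walk n : measurable_fun setT (walk n).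
Proof.
apply: measurable_funM => //; apply: measurable_sum => m.
by apply: (measurableT_comp (f := fun k : int => k%:~R : R)).
Qed.

HB.instance Definition _ n :=
  isMeasurableFun.Build _ _ _ _ (walk n) (measurable_walk n).

Definition walk_RV (n : nat) : {RV P >-> R} := walk n.

End random_walk.

(* Main.v *)
Require Import Defs.
From HB Require Import structures.
From mathcomp Require Import all_boot all_order all_algebra.
From mathcomp Require Import finmap.
From mathcomp Require Import all_classical all_reals all_analysis measurable_realfun.
From mathcomp Require Import complex.
From mathcomp Require Import ring lra zify.

Import Order.TTheory GRing.Theory Num.Theory.
Import numFieldNormedType.Exports.

Local Open Scope classical_set_scope.
Local Open Scope ring_scope.

(**
The steps are symmetric, so the characteristic function of [S_n] is the real
number [(1 - a_n)^n] with [a_n = E (1 - cos (kappa h_n Y))], and it suffices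
that [n a_n] tends to [t kappa^alpha] for [kappa > 0]: then [(1 - a_n)^n] tends
to [exp (- t kappa^alpha)], which is integrable with Fourier transform
[2 pi g_alpha].

For [alpha < 2], writing [k^-(alpha+1)] as a Gamma integral and summing the
resulting geometric series under the integral turns
[sum_k k^-(alpha+1) (1 - cos (k theta))] into [theta^alpha] times an integral
that converges, by domination, to that of [v^(alpha-1) / (1 + v^2)] over the
positive half-line, namely [pi / (2 sin (alpha pi / 2))].  The latter is
computed by expanding [1 / (1 + v^2)] on both sides of [1]: up to the factor
[sin (alpha pi / 2)], the partial sums are the integrals over [[0, pi]] of
[cos (alpha x / 2)] against the Dirichlet kernels, whose Cesaro means tend to
[pi / 2].  For [alpha = 2], comparing [1 - cos x] with [x^2 / 2] for
[k <= 1 / theta] gives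
[sum_k k^-3 (1 - cos (k theta)) = (theta^2 / 2) ln (1 / theta) + O(theta^2)].

Convergence of the characteristic functions yields convergence of the
distribution functions by smoothing with the Cauchy kernel, which is the
Fourier transform of [exp (- e |k|)]: dominated convergence gives
[P (S in [a, b]) <= liminf P (S_n in ]a - del, b + del[)] for every [del > 0].
Since [S] has no atom, applying this inside both half-lines cut at [x] is
enough, as the masses of the half-lines sum to [1].
*)

(** The damping [exp (- e |k|)] restores integrability; [e] is sent to [0] only on the side of the
    limit law, whose characteristic function is integrable.

    The constants come from the size of the series. Its leading term is [theta^alpha pi / (2
    Gamma(alpha + 1) sin (alpha pi / 2))], that is [theta^alpha / (2 b(alpha))]; counting both signs
    of [k], [E (1 - cos (theta Y))] behaves as [mu theta^alpha], and [n mu h_n^alpha = t]. For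
    [alpha = 2] the steps have infinite variance, and the same count gives
    [lambda theta^2 ln (1 / theta)]. This dictates the logarithm in the scaling; replacing
    [ln (1 / (kappa h_n))] by [ln (1 / h_n)] costs a relative error of order [1 / ln (1 / h_n)].

    Comparing the series with a Riemann sum would require the value of the integral of
    [(1 - cos x) / x^(alpha + 1)]; the Gamma representation trades it for an integral with a
    rational factor. *)

Section integration_tools.
Context {R : realType}.

Lemma integrable_le {d} {T : measurableType d} (mu : {measure set T -> \bar R})
    (D : set T) (f g : T -> R) : measurable D -> measurable_fun D f ->
  (forall x, D x -> `|f x| <= g x) -> mu.-integrable D (EFin \o g) ->
  mu.-integrable D (EFin \o f).
Proof.
move=> mD mf fg ig; apply: le_integrable ig => //; first exact/measurable_EFinP.
by move=> x Dx; rewrite /= lee_fin (le_trans (fg x Dx))// ler_norm.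
Qed.

Lemma integrable_bounded {d} {T : measurableType d} (P : probability T R)
    (f : T -> R) (M : R) : measurable_fun setT f -> (forall x, `|f x| <= M) ->
  P.-integrable setT (EFin \o f).
Proof.
move=> mf fM; apply: (integrable_le P setT f (cst M)) => //.
exact: finite_measure_integrable_cst.
Qed.

Context {d1 d2} {T1 : measurableType d1} {T2 : measurableType d2}.
Variables (m1 : {sigma_finite_measure set T1 -> \bar R}).
Variables (m2 : {sigma_finite_measure set T2 -> \bar R}).
Variables (f : T1 * T2 -> R) (g1 : T1 -> R) (g2 : T2 -> R).
Hypothesis mf : measurable_fun setT f.
Hypothesis ig1 : m1.-integrable setT (EFin \o g1).
Hypothesis ig2 : m2.-integrable setT (EFin \o g2).
Hypothesis fg : forall x y, `|f (x, y)| <= g1 x * g2 y.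

(** The iterated integral of the bound splits into a product of two finite integrals. Every exchange
    of integrals below fits this pattern, because at least one variable ranges over a probability
    space or a bounded interval. *)
Lemma integrable_prod_dominated : (m1 \x m2)%E.-integrable setT (EFin \o f).
Proof.
apply/integrable12ltyP; first exact/measurable_EFinP.
have mg1 := measurable_int _ ig1.
have mg2 := measurable_int _ ig2.
have fg' x y : `|f (x, y)| <= `|g1 x| * `|g2 y|.
  by rewrite (le_trans (fg x y))// -normrM ler_norm.
apply: (@le_lt_trans _ _ (\int[m1]_x \int[m2]_y (`|g1 x| * `|g2 y|)%:E)%E).
  apply: ge0_le_integral => //.
  - by move=> x _; exact: integral_ge0.
  - apply: (measurable_fun_fubini_tonelli_F (fun z => `|(EFin \o f) z|)%E) => //.
    by apply/measurableT_comp => //; exact/measurable_EFinP.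
  - apply: (measurable_fun_fubini_tonelli_F
      (fun z => (`|g1 z.1| * `|g2 z.2|)%:E)%E) => //.
    apply/measurable_EFinP/measurable_funM; apply: measurableT_comp => //.
      by apply: measurableT_comp => //; exact/measurable_EFinP.
    by apply: measurableT_comp => //; exact/measurable_EFinP.
  - move=> x _; apply: ge0_le_integral => //.
    + apply: measurableT_comp => //; apply/measurable_EFinP.
      by apply: measurableT_comp => //; exact: measurable_pair1.
    + apply/measurable_EFinP/measurable_funM => //.
      by apply: measurableT_comp => //; exact/measurable_EFinP.
    + by move=> y _; rewrite lee_fin.
have E x : (\int[m2]_y (`|g1 x| * `|g2 y|)%:E =
    (\int[m2]_y `|g2 y|%:E) * `|g1 x|%:E)%E.
  under eq_integral do rewrite EFinM.
  rewrite ge0_integralZl ?lee_fin//; first by rewrite muleC.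
  by apply/measurable_EFinP/measurableT_comp => //; exact/measurable_EFinP.
under eq_integral do rewrite E.
rewrite ge0_integralZl//; last 2 first.
- by apply/measurable_EFinP/measurableT_comp => //; exact/measurable_EFinP.
- by apply: integral_ge0 => y _; rewrite lee_fin.
rewrite lte_mul_pinfty//.
- by apply: integral_ge0 => y _; rewrite lee_fin.
- rewrite ge0_fin_numE; first by case/integrableP : ig2.
  by apply: integral_ge0 => y _; rewrite lee_fin.
- by case/integrableP : ig1.
Qed.

(** The product bound holds at every point, so every slice is integrable and not merely almost every
    one; hence [fine] loses nothing in the inner integrals. *)
Lemma integrable_fubini_slice2 x : m2.-integrable setT (fun y => (f (x, y))%:E).
Proof.
apply: (integrable_le m2 setT _ (fun y => g1 x * g2 y)) => //.
  by apply: measurableT_comp => //; exact: measurable_pair1.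
rewrite (_ : _ \o _ = fun y => (g1 x)%:E * (EFin \o g2) y)%E//.
exact: integrableZl.
Qed.

Lemma integrable_fubini_slice1 y : m1.-integrable setT (fun x => (f (x, y))%:E).
Proof.
apply: (integrable_le m1 setT _ (fun x => g2 y * g1 x)) => //.
- by apply: measurableT_comp => //; exact: measurable_pair2.
- by move=> x _; rewrite mulrC.
rewrite (_ : _ \o _ = fun x => (g2 y)%:E * (EFin \o g1) x)%E//.
exact: integrableZl.
Qed.

Lemma Rintegral_prod12 :
  \int[(m1 \x m2)%E]_z f z = \int[m1]_x \int[m2]_y f (x, y).
Proof.
rewrite /Rintegral -(integral12_prod_meas1 integrable_prod_dominated); congr fine.
apply: eq_integral => x _; rewrite /fubini_F fineK//.
by apply: integrable_fin_num => //; exact: integrable_fubini_slice2.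
Qed.

Lemma Rintegral_fubini :
  \int[m1]_x \int[m2]_y f (x, y) = \int[m2]_y \int[m1]_x f (x, y).
Proof.
rewrite -Rintegral_prod12 /Rintegral.
rewrite -(integral21_prod_meas1 integrable_prod_dominated); congr fine.
apply: eq_integral => x _; rewrite /fubini_G fineK//.
by apply: integrable_fin_num => //; exact: integrable_fubini_slice1.
Qed.

End integration_tools.

Section dominated_convergence_tools.
Context {R : realType} {d} {T : measurableType d}.

Lemma Rdominated_convergence (mu : {measure set T -> \bar R}) (D : set T)
    (f_ : nat -> T -> R) (f g : T -> R) : measurable D ->
  (forall n, measurable_fun D (f_ n)) ->
  (forall x, D x -> f_ n x @[n --> \oo] --> f x) ->
  mu.-integrable D (EFin \o g) ->
  (forall n x, D x -> `|f_ n x| <= g x) ->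
  \int[mu]_(x in D) f_ n x @[n --> \oo] --> \int[mu]_(x in D) f x.
Proof.
move=> mD mf_ f_f ig f_g.
have mf : measurable_fun D f by exact: measurable_fun_cvg mf_ f_f.
have ae_cvg : {ae mu, forall x, D x -> (f_ n x)%:E @[n --> \oo] --> (f x)%:E}.
  by apply: aeW => x Dx; apply: cvg_EFin; [exact: nearW|exact: f_f].
have ae_le : {ae mu, forall x n, D x -> (`|(f_ n x)%:E| <= (g x)%:E)%E}.
  by apply: aeW => x n Dx; rewrite /= lee_fin f_g.
have mf_E n : measurable_fun D (fun x => (f_ n x)%:E).
  exact/measurable_EFinP.
have mfE : measurable_fun D (fun x => (f x)%:E) by exact/measurable_EFinP.
have [intf _] := dominated_convergence mD mf_E mfE ae_cvg ig ae_le.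
have ff : (\int[mu]_(x in D) (f x)%:E)%E \is a fin_num by exact: integrable_fin_num.
by rewrite -(fineK ff) => /fine_cvg.
Qed.

End dominated_convergence_tools.

(** * Sums of independent symmetric steps *)

Section independence.
Context {R : realType} {d} {T : measurableType d} {P : probability T R}.
Variable Y : nat -> {RV P >-> int}.

Definition partial_sum (n : nat) (w : T) : int := \sum_(m < n) Y m w.

(* Each bucket is a singleton or empty. *)
Let bucket (i : nat) : set int := [set k | choice.pickle k = i].

Let bucket_eq i k l : bucket i k -> bucket i l -> k = l.
Proof. by rewrite /bucket/= => <- /(pcan_inj choice.pickleK). Qed.

Let bucket_cover : \bigcup_i bucket i = setT.
Proof. by apply/seteqP; split => // k _; exists (choice.pickle k). Qed.

Let trivIset_bucket m : trivIset setT (fun i => Y m @^-1` bucket i).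
Proof. by move=> i j _ _ [w [/= <- <-]]. Qed.

Lemma measurable_preimage_int m (A : set int) : measurable (Y m @^-1` A).
Proof. by rewrite -[X in measurable X]setTI; exact: measurable_funP. Qed.

Let partial_sumS_bucket n (C : set int) i k : bucket i k ->
  (partial_sum n.+1 @^-1` C) `&` (Y n @^-1` bucket i) =
  (partial_sum n @^-1` [set x | C (x + k)]) `&` (Y n @^-1` bucket i).
Proof.
move=> ik; rewrite /partial_sum; apply/seteqP; split => w /= [];
  by rewrite big_ord_recr/= => Cw iY; rewrite (bucket_eq _ _ _ ik iY) in Cw *.
Qed.

Lemma measurable_partial_sum n : measurable_fun setT (partial_sum n).
Proof.
move=> _ C _; rewrite setTI; elim: n C => [|n IHn] C.
  rewrite (_ : _ @^-1` _ = if 0 \in C then setT else set0).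
    by case: ifP.
  apply/seteqP; split => w; rewrite /partial_sum/= big_ord0.
    by move=> ?; rewrite mem_set.
  by case: ifPn => // /set_mem.
(* Cut along the value [k] of the last step: on each piece, [partial_sum n.+1] lies in [C] exactly
   when [partial_sum n] lies in the translate of [C] by [- k]. *)
rewrite -[X in measurable X]setIT -(preimage_setT (Y n)) -bucket_cover.
rewrite preimage_bigcup setI_bigcupr; apply: bigcup_measurable => i _.
have [->|/set0P[k ik]] := eqVneq (bucket i) set0.
  by rewrite preimage_set0 setI0.
rewrite (partial_sumS_bucket _ _ _ _ ik).
by apply: measurableI; [exact: IHn|exact: measurable_preimage_int].
Qed.

Let measure_bucket m (E : set T) : measurable E ->
  P E = (\sum_(i <oo) P (E `&` (Y m @^-1` bucket i)))%E.
Proof.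
move=> mE; rewrite -measure_semi_bigcup.
- by rewrite -setI_bigcupr -preimage_bigcup bucket_cover preimage_setT setIT.
- by move=> i; apply: measurableI => //; exact: measurable_preimage_int.
- exact/trivIset_setIl/trivIset_bucket.
- apply: bigcup_measurable => i _.
  by apply: measurableI => //; exact: measurable_preimage_int.
Qed.

Hypothesis indepY : mutually_independent Y.

(** Only independence from the next step is wanted, but removing step [n] from the partial sum adds
    the index [n] to the cylinder. The induction therefore carries an arbitrary finite set of later
    indices. *)
Lemma partial_sum_indep_cylinder n (C : set int) (J : {fset nat})
    (A : nat -> set int) : (forall j, j \in J -> (n <= j)%N) ->
  P (partial_sum n @^-1` C `&` \bigcap_(j in [set` J]) (Y j @^-1` A j)) =
  (P (partial_sum n @^-1` C) * \prod_(j <- J) P (Y j @^-1` A j))%E.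
Proof.
elim: n C J A => [|n IHn] C J A nJ.
  have -> : partial_sum 0 @^-1` C = if 0 \in C then setT else set0.
    apply/seteqP; split => w; rewrite /partial_sum/= big_ord0.
      by move=> ?; rewrite mem_set.
    by case: ifPn => // /set_mem.
  case: ifPn => _; last by rewrite set0I measure0 mul0e.
  by rewrite setTI probability_setT mul1e indepY.
have mC m B : measurable (partial_sum m @^-1` B).
  by rewrite -[X in measurable X]setTI; exact: measurable_partial_sum.
set B := \bigcap_(_ in _) _.
have mB : measurable B.
  by apply: bigcap_measurableType => j _; exact: measurable_preimage_int.
have nJ' : n \notin J by apply/negP => /nJ; rewrite ltnn.
(* With the value of step [n] fixed, both events are a condition on [partial_sum n] and a cylinder,
   over [J] with [n] added on the left and over [n] alone on the right. The induction hypothesis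
   applies to each. *)
have key i : P ((partial_sum n.+1 @^-1` C `&` B) `&` (Y n @^-1` bucket i)) =
    ((\prod_(j <- J) P (Y j @^-1` A j)) *
      P (partial_sum n.+1 @^-1` C `&` (Y n @^-1` bucket i)))%E.
  have [->|/set0P[k ik]] := eqVneq (bucket i) set0.
    by rewrite preimage_set0 !setI0 measure0 mule0.
  pose A' (D : set int) j := if j == n then D else A j.
  rewrite setIAC !(partial_sumS_bucket _ _ _ _ ik).
  have E D : (Y n @^-1` D) `&` B =
      \bigcap_(j in [set` (n |` J)%fset]) (Y j @^-1` A' D j).
    apply/seteqP; split => w.
      move=> [YD Bw] j; rewrite /= !inE => /orP[/eqP->|jJ].
        by rewrite /A' eqxx.
      by rewrite /A'; case: eqP => [->//|_]; exact: Bw.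
    move=> H; split.
      by have := H n; rewrite /= !inE eqxx /A' eqxx; exact.
    move=> j jJ; have := H j; rewrite /= !inE.
    have -> : (j == n) = false by apply/negP => /eqP jn; rewrite -jn jJ in nJ'.
    by rewrite /A' => /(_ jJ); have -> : (j == n) = false
      by apply/negP => /eqP jn; rewrite -jn jJ in nJ'.
  have E' D : Y n @^-1` D =
      \bigcap_(j in [set` [fset n]%fset]) (Y j @^-1` (fun=> D) j).
    apply/seteqP; split => w; first by move=> ? j; rewrite /= inE => /eqP ->.
    by move=> /(_ n); rewrite /= inE; exact.
  rewrite -setIA E IHn; last first.
    by move=> j; rewrite !inE => /orP[/eqP->//|/nJ/ltnW].
  rewrite [in RHS]E' IHn; last by move=> j; rewrite !inE => /eqP->.
  rewrite big_fsetU1//= big_seq_fset1 /A' eqxx.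
  rewrite (eq_big_seq (fun j => P (Y j @^-1` A j))).
    by rewrite muleA muleC.
  by move=> j jJ /=; case: eqP => // jn; rewrite -jn jJ in nJ'.
rewrite (measure_bucket n); last exact: measurableI.
under eq_eseriesr do rewrite key.
have -> : (\prod_(j <- J) P (Y j @^-1` A j) = (fine (P B))%:E)%E.
  by rewrite -indepY// fineK// fin_num_measure.
by rewrite nneseriesZl// muleC -measure_bucket.
Qed.

Lemma partial_sum_indep n (A B : set int) :
  P ((partial_sum n @^-1` A) `&` (Y n @^-1` B)) =
  (P (partial_sum n @^-1` A) * P (Y n @^-1` B))%E.
Proof.
have := partial_sum_indep_cylinder n A [fset n]%fset (fun=> B).
rewrite big_seq_fset1 (_ : \bigcap_(_ in _) _ = Y n @^-1` B); last first.
  apply/seteqP; split => w; last by move=> ? j; rewrite /= inE => /eqP ->.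
  by move=> /(_ n); rewrite /= inE; exact.
by apply => j; rewrite inE => /eqP->.
Qed.

HB.instance Definition _ n := isMeasurableFun.Build _ _ _ _ (partial_sum n)
  (measurable_partial_sum n).

Let joint n (w : T) : int * int := (partial_sum n w, Y n w).

Let measurable_joint n : measurable_fun setT (joint n).
Proof.
by apply: measurable_fun_pair => //; exact: measurable_partial_sum.
Qed.

HB.instance Definition _ n := isMeasurableFun.Build _ _ _ _ (joint n)
  (measurable_joint n).

(** Independence on rectangles identifies the joint law of [partial_sum n] and [Y n] with the
    product of their laws, by uniqueness of the product measure; Fubini then separates the
    factors. *)
Lemma expectation_partial_sum_mul n (F G : int -> R) (M : R) :
  (forall k, `|F k| <= M) -> (forall k, `|G k| <= M) ->
  \int[P]_w (F (partial_sum n w) * G (Y n w)) =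
  \int[P]_w (F (partial_sum n w)) * \int[P]_w (G (Y n w)).
Proof.
move=> FM GM.
have mint (H : int -> R) : measurable_fun setT H by [].
have mFG : measurable_fun setT (fun z : int * int => F z.1 * G z.2).
  by apply: measurable_funM; apply: measurableT_comp.
pose nu := distribution P (partial_sum n); pose eta := distribution P (Y n).
have iF : nu.-integrable setT (EFin \o F) by exact: integrable_bounded FM.
have iG : eta.-integrable setT (EFin \o G) by exact: integrable_bounded GM.
have -> : \int[P]_w (F (partial_sum n w) * G (Y n w)) =
    \int[(nu \x eta)%E]_z (F z.1 * G z.2).
  rewrite /Rintegral; congr fine.
  rewrite (eq_measure_integral (distribution P (joint n))); last first.
    move=> X mX _; apply: product_measure_unique => // A B _ _.
    exact: partial_sum_indep.
  rewrite integral_distribution//; first exact/measurable_EFinP.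
  apply: (integrable_bounded P _ (M * M)).
    by apply: measurable_funM; apply: measurableT_comp.
  by move=> w /=; rewrite normrM ler_pM.
rewrite (Rintegral_prod12 nu eta _ (fun x => `|F x|) (fun x => `|G x|))//.
- under eq_Rintegral do rewrite /= RintegralZl//.
  rewrite RintegralZr//; congr (_ * _); rewrite /Rintegral; congr fine.
    rewrite integral_distribution//.
    by apply: (integrable_bounded P _ M) => [|w]; [exact: measurableT_comp|exact: FM].
  rewrite integral_distribution//.
  by apply: (integrable_bounded P _ M) => [|w]; [exact: measurableT_comp|exact: GM].
- by apply: (integrable_bounded nu _ M) => // x; rewrite normr_id.
- by apply: (integrable_bounded eta _ M) => // x; rewrite normr_id.
- by move=> x y /=; rewrite normrM.
Qed.

End independence.

(** * Characteristic functions of symmetric integer steps *)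

Section characteristic_function.
Context {R : realType}.

Lemma measure_int_eq (mu nu : {measure set int -> \bar R}) :
  (forall k, mu [set k] = nu [set k]) -> forall A, mu A = nu A.
Proof.
move=> munu A; pose B i : set int := A `&` [set k | choice.pickle k = i].
have -> : A = \bigcup_i B i.
  apply/seteqP; split => [k Ak|k [i _ []]//].
  by exists (choice.pickle k).
rewrite !measure_semi_bigcup//; try by move=> i j _ _ [k [[_ <-] [_ <-]]].
apply: eq_eseriesr => i _.
have [->|/set0P[k [Ak ki]]] := eqVneq (B i) set0; first by rewrite !measure0.
suff -> : B i = [set k] by [].
apply/seteqP; split => [l [Al li]|l ->//].
by rewrite /= in ki li *; apply: (pcan_inj choice.pickleK); rewrite li ki.
Qed.

Context {d} {T : measurableType d} {P : probability T R}.
Variables (Y : nat -> {RV P >-> int}) (p : int -> R).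
Hypothesis pY : forall m k, P (Y m @^-1` [set k]) = (p k)%:E.
Hypothesis p_sym : forall k, p (- k) = p k.

Let integral_dist (X : {RV P >-> int}) (F : int -> R) (M : R) :
  (forall k, `|F k| <= M) ->
  \int[P]_w F (X w) = \int[distribution P X]_k F k.
Proof.
move=> FM; rewrite /Rintegral integral_distribution//.
by apply: (integrable_bounded P _ M) => [|w]; [exact: measurableT_comp|exact: FM].
Qed.

Lemma expectation_step m (F : int -> R) (M : R) : (forall k, `|F k| <= M) ->
  \int[P]_w F (Y m w) = \int[P]_w F (Y 0%N w).
Proof.
move=> FM; rewrite !(integral_dist _ _ _ FM) /Rintegral; congr fine.
apply: eq_measure_integral => A _ _; apply: measure_int_eq => k.
by transitivity ((p k)%:E); [exact: pY|exact/esym/pY].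
Qed.

Let oppY m (w : T) : int := - Y m w.

Let measurable_oppY m : measurable_fun setT (oppY m).
Proof. by apply: (measurableT_comp (f := -%R : int -> int)). Qed.

HB.instance Definition _ m := isMeasurableFun.Build _ _ _ _ (oppY m)
  (measurable_oppY m).

Lemma expectation_step_opp m (F : int -> R) (M : R) : (forall k, `|F k| <= M) ->
  \int[P]_w F (- Y m w) = \int[P]_w F (Y m w).
Proof.
move=> FM; rewrite -[LHS]/(\int[P]_w F (oppY m w)).
rewrite !(integral_dist _ _ _ FM) /Rintegral; congr fine.
apply: eq_measure_integral => A _ _; apply: measure_int_eq => k.
transitivity ((p k)%:E); last exact/esym/pY.
rewrite -p_sym -(pY m) /distribution/= /pushforward.
congr (P _); apply/seteqP.
by split => w; rewrite /= /oppY; [move=> <-; rewrite opprK|move=> ->; rewrite opprK].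
Qed.

(* The steps are symmetric: the imaginary part vanishes. *)
Definition step_cf (theta : R) := \int[P]_w cos (theta * (Y 0%N w)%:~R).

Let cosM (theta : R) (k : int) : `|cos (theta * k%:~R)| <= 1.
Proof. exact: cos_max. Qed.

Let sinM (theta : R) (k : int) : `|sin (theta * k%:~R)| <= 1.
Proof. exact: sin_max. Qed.

Lemma expectation_sin_step m theta : \int[P]_w sin (theta * (Y m w)%:~R) = 0.
Proof.
have := expectation_step_opp m _ _ (sinM theta).
under eq_Rintegral do rewrite mulrNz mulrN sinN -mulN1r.
rewrite RintegralZl//; first by move=> ?; lra.
apply: (integrable_bounded P _ 1) => [|w]; last exact: sinM.
exact: (measurableT_comp (f := fun k : int => sin (theta * k%:~R))).
Qed.

Hypothesis indepY : mutually_independent Y.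

(** Real form of the multiplicativity of characteristic functions. Cosine and sine are carried
    together because each addition formula involves both; every term containing a sine of the new
    step vanishes by symmetry. *)
Lemma expectation_cos_sin_partial_sum theta n :
  \int[P]_w cos (theta * (partial_sum Y n w)%:~R) = step_cf theta ^+ n /\
  \int[P]_w sin (theta * (partial_sum Y n w)%:~R) = 0.
Proof.
pose C (k : int) := cos (theta * k%:~R); pose S (k : int) := sin (theta * k%:~R).
have CM k : `|C k| <= 1 by exact: cosM.
have SM k : `|S k| <= 1 by exact: sinM.
have psS m w : partial_sum Y m.+1 w = (partial_sum Y m w + Y m w)%R.
  by rewrite /partial_sum big_ord_recr.
have iFG (F G : int -> R) m : (forall k, `|F k| <= 1) -> (forall k, `|G k| <= 1) ->
    P.-integrable setT (fun w => (F (partial_sum Y m w) * G (Y m w))%:E).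
  move=> F1 G1; apply: (integrable_bounded P _ 1) => [|w].
    apply: measurable_funM; last exact: measurableT_comp.
    by apply: measurableT_comp => //; exact: measurable_partial_sum.
  by rewrite normrM -[leRHS]mulr1 ler_pM.
elim: n => [|n [IHc IHs]].
  rewrite /partial_sum; under eq_Rintegral do rewrite big_ord0 mulr0 cos0.
  under [X in _ /\ X = _]eq_Rintegral do rewrite big_ord0 mulr0 sin0.
  by rewrite !Rintegral_cst//= probability_setT/= mulr1 mul0r expr0.
rewrite (@eq_Rintegral _ _ _ P setT (fun w => C (partial_sum Y n w) * C (Y n w) -
    S (partial_sum Y n w) * S (Y n w))); last first.
  by move=> w _; rewrite psS intrD mulrDr cosD.
rewrite [X in _ /\ X = _](@eq_Rintegral _ _ _ P setT (fun w =>
    S (partial_sum Y n w) * C (Y n w) + C (partial_sum Y n w) * S (Y n w))); last first.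
  by move=> w _; rewrite psS intrD mulrDr sinD.
rewrite RintegralB//; [|exact: iFG..].
rewrite RintegralD//; [|exact: iFG..].
rewrite !(expectation_partial_sum_mul _ indepY _ _ _ 1)//.
rewrite IHc IHs (expectation_sin_step n theta) (expectation_step n _ _ CM).
by rewrite exprSr !(mulr0, mul0r) subr0 addr0.
Qed.

(** The space is cut along [|Y|], which merges [k] and [- k] and gives the factor 2; the piece
    [Y = 0] contributes [1 - cos 0 = 0], so the index starts at [k = 1]. Working with [1 - cos]
    keeps all terms nonnegative, so no summability is to be checked. *)
Lemma step_cf_series theta : (1 - step_cf theta)%:E =
  (\sum_(i <oo) (2 * p (Posz i.+1) * (1 - cos (theta * i.+1%:R)))%:E)%E.
Proof.
pose A (i : nat) : set T := Y 0%N @^-1` [set k : int | `|k|%N = i].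
have mA i : measurable (A i) by exact: measurable_preimage_int.
have tA : trivIset setT A by move=> i j _ _ [w [/= <- <-]].
have UA : \bigcup_i A i = setT.
  by apply/seteqP; split => // w _; exists `|Y 0%N w|%N.
have mcos : measurable_fun setT (fun w : T => cos (theta * (Y 0%N w)%:~R)).
  exact: (measurableT_comp (f := fun k : int => cos (theta * k%:~R))).
have cos_ge0 (x : R) : 0 <= 1 - cos x by rewrite subr_ge0 cos_le1.
have -> : (1 - step_cf theta)%:E = (\int[P]_w (1 - cos (theta * (Y 0%N w)%:~R))%:E)%E.
  have i1 : P.-integrable setT (fun w => (1 : R)%:E).
    by apply: (integrable_bounded P (cst 1) 1) => // w; rewrite normr1.
  have ic : P.-integrable setT (fun w => (cos (theta * (Y 0%N w)%:~R))%:E).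
    by apply: (integrable_bounded P _ 1) => // w; exact: cosM.
  rewrite integralB_EFin// integral_cst// [X in (_ * X)%E](_ : _ = 1%E) ?mule1 ?EFinB; last exact: probability_setT.
  by congr (_ - _)%E; rewrite /step_cf /Rintegral fineK//; exact: integrable_fin_num.
have mcosU : measurable_fun (\bigcup_i A i)
    (fun w => (1 - cos (theta * (Y 0%N w)%:~R))%:E).
  by rewrite UA; apply/measurable_EFinP/measurable_funB.
rewrite -UA ge0_integral_bigcup//.
have E i : (\int[P]_(w in A i) (1 - cos (theta * (Y 0%N w)%:~R))%:E =
    (1 - cos (theta * i%:R))%:E * P (A i))%E.
  rewrite -integral_cst//; apply: eq_integral => w /[!inE] /= iw.
  congr (_%:E); congr (1 - _); rewrite -iw.
  have [k0|/ltW k0] := leP 0 (Y 0%N w).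
    by congr (cos (_ * _)); rewrite natr_absz ger0_norm.
  by rewrite natr_absz ler0_norm// mulrNz mulrN cosN.
have I0 i : (0 <= \int[P]_(w in A i) (1 - cos (theta * (Y 0%N w)%:~R))%:E)%E.
  by apply: integral_ge0 => w _; rewrite lee_fin.
rewrite nneseries_recl// -nneseries_addn// E mulr0 cos0 subrr mul0e add0e.
apply: eq_eseriesr => i _; rewrite addn1.
rewrite E (_ : A i.+1 = Y 0%N @^-1` [set Posz i.+1] `|` Y 0%N @^-1` [set Negz i]).
  rewrite measureU//; [|exact: measurable_preimage_int..|]; last first.
    by apply/seteqP; split => // w [/= ->].
  transitivity ((1 - cos (theta * i.+1%:R))%:E *
      ((p (Posz i.+1))%:E + (p (Negz i))%:E))%E.
    by congr (_ * (_ + _))%E; exact: pY.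
  by rewrite NegzE p_sym -EFinD -EFinM; congr EFin; ring.
apply/seteqP; split => w; rewrite /A/=; case: (Y 0%N w) => k /=.
- by move=> ->; left.
- by move=> [->]; right.
- by case => // -[->].
- by case => // -[->].
Qed.

End characteristic_function.

(** * Smoothing by the Cauchy kernel *)

Section calculus_tools.
Context {R : realType}.
Notation mu := (@lebesgue_measure R).

Lemma derivable_continuous (f : R -> R) :
  (forall x, derivable f x 1) -> continuous f.
Proof.
by move=> df x; apply/differentiable_continuous/derivable1_diffP/df.
Qed.

Lemma measurable_cos : measurable_fun setT (@cos R).
Proof. by apply: continuous_measurable_fun; exact: continuous_cos. Qed.

Lemma measurable_sin : measurable_fun setT (@sin R).
Proof. by apply: continuous_measurable_fun; exact: continuous_sin. Qed.

Lemma integrable_continuous_itvcc (f : R -> R) a b : continuous f ->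
  mu.-integrable `[a, b] (EFin \o f).
Proof.
move=> cf; apply: continuous_compact_integrable; first exact: segment_compact.
exact: continuous_subspaceT.
Qed.

Lemma FTC2_is_derive (F f : R -> R) a b : a <= b ->
  (forall x, is_derive x (1 : R) F (f x)) -> continuous f ->
  \int[mu]_(x in `[a, b]) f x = F b - F a.
Proof.
rewrite le_eqVlt => /predU1P[<- _ _|ab dF cf].
  by rewrite set_itv1 Rintegral_set1 subrr.
have cF : continuous F by apply: derivable_continuous => x; apply: ex_derive.
rewrite /Rintegral (@continuous_FTC2 _ f F)//.
- exact: continuous_subspaceT.
- split.
  + by move=> x _; apply: ex_derive.
  + by apply: cvg_at_right_filter; exact: cF.
  + by apply: cvg_at_left_filter; exact: cF.
- by move=> x _; rewrite derive1E; exact: derive_val.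
Qed.

Lemma FTC2y_is_derive (F f : R -> R) a l : (forall x, 0 <= f x) ->
  (forall x, is_derive x (1 : R) F (f x)) -> continuous f ->
  F x @[x --> +oo] --> l ->
  (\int[mu]_(x in `[a, +oo[) (f x)%:E = (l - F a)%:E)%E.
Proof.
move=> f0 dF cf Fl.
have cF : continuous F by apply: derivable_continuous => x; apply: ex_derive.
rewrite (ge0_continuous_FTC2y _ _ Fl)//.
- exact: continuous_subspaceT.
- by apply: cvg_at_right_filter; exact: cF.
- by move=> x _; rewrite derive1E; exact: derive_val.
Qed.

Lemma cvg_expRN_M (e : R) : 0 < e -> expR (- (e * x)) @[x --> +oo] --> (0 : R).
Proof.
move=> e0.
apply: (@cvg_comp _ _ _ (fun x => e * x) (fun z => expR (- z)) _ (pinfty_nbhs R)).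
  exact: gt0_cvgMry.
exact: cvgr_expR.
Qed.

End calculus_tools.

(** * The Cauchy kernel as a Fourier transform *)

Section cauchy_kernel.
Context {R : realType}.
Notation mu := (@lebesgue_measure R).
Variables (e z : R).
Hypothesis e_gt0 : 0 < e.

Let denom_neq0 : e ^+ 2 + z ^+ 2 != 0.
Proof. by rewrite gt_eqF// ltr_wpDr ?sqr_ge0// exprn_gt0. Qed.

(** Adding 1 to the cosine makes the integrand nonnegative, as the fundamental theorem on a
    half-line and the reduction by symmetry require. The extra term is subtracted in
    [cauchy_kernelE]. *)
Let h (k : R) := expR (- (e * `|k|)) * (1 + cos (k * z)).

Let h_ge0 k : 0 <= h k.
Proof. by rewrite mulr_ge0 ?expR_ge0//; have := cos_geN1 (k * z); lra. Qed.

Let continuous_h : continuous h.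
Proof.
move=> k; apply: cvgM.
  apply: (@continuous_comp _ _ _ (fun k => - (e * `|k|)) expR); last first.
    exact: continuous_expR.
  by apply: cvgN; apply: cvgM; [exact: cvg_cst|exact: norm_continuous].
apply: (@derivable_continuous _ (fun k => 1 + cos (k * z))) => x.
by apply: ex_derive.
Qed.

Lemma integral_half_cauchy_kernel :
  (\int[mu]_(k in `[0%R, +oo[) (expR (- (e * k)) * (1 + cos (k * z)))%:E =
   (e^-1 + e / (e ^+ 2 + z ^+ 2))%:E)%E.
Proof.
have e0 : e != 0 by rewrite gt_eqF.
(* The second summand is the real part of [exp ((- e + i z) k) / (- e + i z)]. *)
pose F k := - (expR (- (e * k)) / e) +
  expR (- (e * k)) * (z * sin (k * z) - e * cos (k * z)) / (e ^+ 2 + z ^+ 2).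
have dF x : is_derive x (1 : R) F (expR (- (e * x)) * (1 + cos (x * z))).
  apply: is_derive_eq; rewrite /GRing.scale/=; field.
  by rewrite ?e0 ?denom_neq0.
rewrite (@FTC2y_is_derive _ _ _ 0 0 _ dF) /F.
- by rewrite !(mul0r, mulr0, oppr0, expR0, sin0, cos0); congr EFin; field;
    rewrite ?e0 ?denom_neq0.
- by move=> k; rewrite mulr_ge0 ?expR_ge0//; have := cos_geN1 (k * z); lra.
- by apply: derivable_continuous => x; apply: ex_derive.
- apply/norm_cvg0P.
  apply: (@squeeze_cvgr _ _ _ _ (fun=> 0)
    (fun k => expR (- (e * k)) * (e^-1 + (`|z| + e) / (e ^+ 2 + z ^+ 2)))).
  + near=> k; rewrite normr_ge0/= -mulrN -!mulrA -mulrDr normrM.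
    rewrite ger0_norm ?expR_ge0// ler_wpM2l ?expR_ge0//.
    rewrite (le_trans (ler_normD _ _))// normrN gtr0_norm ?invr_gt0// lerD2l.
    rewrite normrM [X in _ * X]ger0_norm ?invr_ge0 ?addr_ge0 ?sqr_ge0//.
    rewrite ler_wpM2r ?invr_ge0 ?addr_ge0 ?sqr_ge0//.
    rewrite (le_trans (ler_normB _ _))// !normrM (gtr0_norm e_gt0) lerD//.
      by rewrite ler_piMr ?sin_max.
    by rewrite ler_piMr ?cos_max// ltW.
  + exact: cvg_cst.
  + by rewrite -[X in _ --> X](mul0r (e^-1 + (`|z| + e) / (e ^+ 2 + z ^+ 2)));
      apply: cvgM; [exact: cvg_expRN_M|exact: cvg_cst].
Unshelve. all: by end_near. Qed.

Lemma integral_cauchy_kernel1 :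
  (\int[mu]_k (h k)%:E = (2 / e + 2 * e / (e ^+ 2 + z ^+ 2))%:E)%E.
Proof.
rewrite ge0_symfun_integralT//; last first.
  by move=> k; rewrite /h /= normrN mulNr cosN.
have -> : (\int[mu]_(k in [set x : R | (0 <= x)%R]) (h k)%:E =
    \int[mu]_(k in `[0%R, +oo[) (expR (- (e * k)) * (1 + cos (k * z)))%:E)%E.
  rewrite -set_itvcy; apply: eq_integral => k.
  by rewrite inE/= in_itv/= andbT => k0; rewrite /h ger0_norm.
by rewrite integral_half_cauchy_kernel -EFinM; congr EFin; ring.
Qed.

End cauchy_kernel.

Section cauchy_kernel_theory.
Context {R : realType}.
Notation mu := (@lebesgue_measure R).
Variables (e z : R).
Hypothesis e_gt0 : 0 < e.

Lemma measurable_expRN_norm : measurable_fun setT (fun k : R => expR (- (e * `|k|))).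
Proof.
apply: measurableT_comp => //; apply: measurableT_comp => //.
by apply: measurable_funM => //; exact: normr_measurable.
Qed.

Lemma integrable_expRN_norm :
  mu.-integrable setT (EFin \o (fun k => expR (- (e * `|k|)))).
Proof.
apply/integrableP; split.
  by apply/measurable_EFinP; exact: measurable_expRN_norm.
have := integral_cauchy_kernel1 e 0 e_gt0.
under eq_integral do rewrite mulr0 cos0 EFinM.
move=> H; apply: (@le_lt_trans _ _ (\int[mu]_k (expR (- (e * `|k|)) * (1 + 1))%:E)%E).
  apply: ge0_le_integral => //.
  - apply: measurableT_comp => //; apply/measurable_EFinP.
    exact: measurable_expRN_norm.
  - by apply/measurable_EFinP/measurable_funM => //; exact: measurable_expRN_norm.
  - move=> k _; rewrite /= lee_fin ger0_norm ?expR_ge0//.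
    by rewrite ler_peMr ?expR_ge0//; lra.
under eq_integral do rewrite EFinM; by rewrite H ltry.
Qed.

Lemma measurable_cauchy_kernel : measurable_fun setT
  (fun k : R => expR (- (e * `|k|)) * cos (k * z)).
Proof.
apply: measurable_funM; first exact: measurable_expRN_norm.
apply: continuous_measurable_fun.
apply: (@derivable_continuous _ (fun k => cos (k * z))) => x.
by apply: ex_derive.
Qed.

Lemma integrable_cauchy_kernel :
  mu.-integrable setT (EFin \o (fun k => expR (- (e * `|k|)) * cos (k * z))).
Proof.
apply: integrable_le integrable_expRN_norm => //.
  exact: measurable_cauchy_kernel.
move=> k _; rewrite normrM ger0_norm ?expR_ge0// -[leRHS]mulr1.
by rewrite ler_wpM2l ?expR_ge0// cos_max.
Qed.

Lemma cauchy_kernelE : \int[mu]_k (expR (- (e * `|k|)) * cos (k * z)) =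
  2 * e / (e ^+ 2 + z ^+ 2).
Proof.
have H y : \int[mu]_k (expR (- (e * `|k|)) * (1 + cos (k * y))) =
    2 / e + 2 * e / (e ^+ 2 + y ^+ 2).
  by rewrite /Rintegral integral_cauchy_kernel1.
have := H z; under eq_Rintegral do rewrite mulrDr mulr1.
rewrite RintegralD//; [|exact: integrable_expRN_norm|exact: integrable_cauchy_kernel].
(* At [z = 0] the formula evaluates the integral of the exponential alone, which is what has to be
   subtracted. *)
have := H 0; under eq_Rintegral do rewrite mulr0 cos0 mulrDr mulr1.
rewrite RintegralD//; [|exact: integrable_expRN_norm..].
have e0 : e != 0 by rewrite gt_eqF.
have -> : 2 * e / (e ^+ 2 + 0 ^+ 2) = 2 / e by field.
set A := Rintegral _ _ _; set B := Rintegral _ _ _.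
by move: A B => A B; clear H; lra.
Qed.

End cauchy_kernel_theory.

(** * Smoothed laws on bounded intervals *)

Section smoothing.
Context {R : realType}.
Notation mu := (@lebesgue_measure R).

Lemma Rintegral_itv_indic (f : R -> R) (D : set R) :
  \int[mu]_(y in D) f y = \int[mu]_y (\1_D y * f y).
Proof.
rewrite Rintegral_mkcond; apply: eq_Rintegral => y _.
rewrite patchE indicE; case: ifP => _; by rewrite ?mul1r ?mul0r.
Qed.

Lemma measurable_cosM_prod : measurable_fun setT (fun z : R * R => cos (z.2 * z.1)).
Proof.
apply: (measurableT_comp (f := cos)).
  exact: measurable_cos.
by apply: measurable_funM.
Qed.

Section cos_transform.
Variables (a b : R) (G : R -> R).
Hypothesis iG : mu.-integrable setT (EFin \o G).

Let v (w : R -> R) (z : R * R) := \1_(`[a, b]%classic) z.1 * (w z.2 * cos (z.2 * z.1)).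

Let mv (w : R -> R) : measurable_fun setT w -> measurable_fun setT (v w).
Proof.
move=> mw; apply: measurable_funM; first exact: measurableT_comp.
apply: measurable_funM; last exact: measurable_cosM_prod.
exact: measurableT_comp.
Qed.

Let vG (w : R -> R) : (forall k, `|w k| <= G k) ->
  forall y k, `|v w (y, k)| <= \1_(`[a, b]%classic) y * G k.
Proof.
move=> wG y k; rewrite /v/= normrM ger0_norm// ler_wpM2l//.
by rewrite normrM (le_trans _ (wG k))// ler_piMr// cos_max.
Qed.

Let indic_cos_transform (w : R -> R) y : measurable_fun setT w ->
  (forall k, `|w k| <= G k) ->
  \int[mu]_k v w (y, k) =
  \1_(`[a, b]%classic) y * \int[mu]_k (w k * cos (k * y)).
Proof.
move=> mw wG; rewrite /v/= RintegralZl//; apply: integrable_le iG => //.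
  apply: measurable_funM => //; apply: (measurableT_comp measurable_cos).
  exact: measurable_funM.
by move=> k _; rewrite normrM (le_trans _ (wG k))// ler_piMr// cos_max.
Qed.

(** Read as one integral over the plane, the double integral has the integrable bound [G k] times
    the indicator of [[a, b]] at [y], so pointwise convergence of the [u_ n] suffices. It serves
    twice: for [phi n] tending to [psi] at fixed damping, and for the removal of the damping. *)
Lemma cvg_Rintegral_cos_transform (u_ : nat -> R -> R) (u : R -> R) :
  (forall n, measurable_fun setT (u_ n)) ->
  (forall k, u_ n k @[n --> \oo] --> u k) ->
  (forall n k, `|u_ n k| <= G k) ->
  \int[mu]_(y in `[a, b]) \int[mu]_k (u_ n k * cos (k * y)) @[n --> \oo] -->
  \int[mu]_(y in `[a, b]) \int[mu]_k (u k * cos (k * y)).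
Proof.
move=> mu_ u_u u_G.
have vE (w : R -> R) : measurable_fun setT w -> (forall k, `|w k| <= G k) ->
    \int[mu]_(y in `[a, b]) \int[mu]_k (w k * cos (k * y)) =
    \int[(mu \x mu)%E]_z v w z.
  move=> mw wG; rewrite (Rintegral_prod12 mu mu (v w) \1_(`[a, b]%classic) G).
  - rewrite Rintegral_itv_indic; apply: eq_Rintegral => y _.
    by rewrite indic_cos_transform.
  - exact: mv.
  - exact: integrable_indic_itv.
  - exact: iG.
  - exact: vG.
have mu' : measurable_fun setT u by exact: measurable_fun_cvg mu_ _.
have uG k : `|u k| <= G k.
  apply: (ler_cvg_to (cvg_norm (u_u k)) (cvg_cst (G k))).
  by apply: nearW => n; exact: u_G.
rewrite vE//; under eq_cvg do rewrite vE//.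
apply: (Rdominated_convergence (mu \x mu)%E setT (fun n => v (u_ n)) (v u)
  (fun z => \1_(`[a, b]%classic) z.1 * G z.2)) => //.
- by move=> n; exact: mv.
- move=> [y k] _; apply: cvgM; first exact: cvg_cst.
  by apply: cvgM; [exact: u_u|exact: cvg_cst].
- apply: (integrable_prod_dominated mu mu _ \1_(`[a, b]%classic) (fun k => `|G k|)) => //.
  + apply: measurable_funM; apply: measurableT_comp => //.
    by apply/measurable_EFinP; exact: measurable_int iG.
  + exact: integrable_indic_itv.
  + exact: integrable_norm.
  + by move=> y k; rewrite normrM ger0_norm.
- by move=> n [y k] _; exact: vG.
Qed.

Lemma integrable_cos_transform (w : R -> R) : measurable_fun setT w ->
  (forall k, `|w k| <= G k) ->
  mu.-integrable `[a, b] (EFin \o (fun y => \int[mu]_k (w k * cos (k * y)))).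
Proof.
move=> mw wG.
have iv : (mu \x mu)%E.-integrable setT (EFin \o v w).
  apply: (integrable_prod_dominated mu mu _ \1_(`[a, b]%classic) G) => //.
  - exact: mv.
  - exact: integrable_indic_itv.
  - exact: vG.
have iT : mu.-integrable setT (EFin \o (fun y => \int[mu]_k v w (y, k))).
  rewrite (_ : EFin \o _ = fubini_F mu (EFin \o v w)).
    exact: integrable_fubini_F.
  apply/funext => y; rewrite /fubini_F /Rintegral/= fineK//.
  apply: integrable_fin_num => //.
  apply: (integrable_fubini_slice2 mu (v w) \1_(`[a, b]%classic) G) => //.
  - exact: mv.
  - exact: vG.
have iab : mu.-integrable `[a, b] (EFin \o (fun y => \int[mu]_k v w (y, k))).
  by apply: integrableS iT.
apply: eq_integrable iab => // y /set_mem yab; rewrite /= indic_cos_transform// indicE.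
by rewrite mem_set// mul1r.
Qed.

End cos_transform.

Section smoothed_law.
Context {d} {T : measurableType d} {P : probability T R}.
Variables (X : {RV P >-> R}) (phi : R -> R).
Hypothesis cos_phi : forall k, \int[P]_w cos (k * X w) = phi k.
Hypothesis sin_0 : forall k, \int[P]_w sin (k * X w) = 0.

Let mcos c : measurable_fun setT (fun w => cos (c * X w)).
Proof. by apply: (measurableT_comp measurable_cos); exact: measurable_funM. Qed.

Let msin c : measurable_fun setT (fun w => sin (c * X w)).
Proof. by apply: (measurableT_comp measurable_sin); exact: measurable_funM. Qed.

Let icos c : P.-integrable setT (EFin \o (fun w => cos (c * X w))).
Proof. by apply: (integrable_bounded P _ 1) => // w; exact: cos_max. Qed.

Let isin c : P.-integrable setT (EFin \o (fun w => sin (c * X w))).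
Proof. by apply: (integrable_bounded P _ 1) => // w; exact: sin_max. Qed.

Lemma expectation_cos_shift k y :
  \int[P]_w cos (k * (X w - y)) = phi k * cos (k * y).
Proof.
under eq_Rintegral do rewrite mulrBr cosB.
rewrite RintegralD//=; last 2 first.
- apply: (integrable_bounded P _ 1) => [|w]; first exact: measurable_funM.
  by rewrite normrM mulr_ile1// cos_max.
- apply: (integrable_bounded P _ 1) => [|w]; first exact: measurable_funM.
  by rewrite normrM mulr_ile1// sin_max.
rewrite !RintegralZr//.
transitivity (phi k * cos (k * y) + 0 * sin (k * y)); last by rewrite mul0r addr0.
by congr (_ * _ + _ * _); [exact: cos_phi|exact: sin_0].
Qed.

Lemma measurable_cf : measurable_fun setT phi.
Proof.
rewrite (_ : phi = fun k => \int[P]_w cos (k * X w)); last first.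
  by apply/funext => k; rewrite cos_phi.
(* Tonelli gives measurability of partial integrals of nonnegative functions, hence the cosine
   raised by 1. *)
have H : measurable_fun setT (fubini_F P (fun z : R * T => (1 + cos (z.1 * X z.2))%:E)).
  apply: measurable_fun_fubini_tonelli_F => [|z]; last first.
    by rewrite lee_fin; have := cos_geN1 (z.1 * X z.2); lra.
  apply/measurable_EFinP/measurable_funD => //.
  apply: (measurableT_comp measurable_cos); apply: measurable_funM => //.
  exact: measurableT_comp.
have -> : (fun k => \int[P]_w cos (k * X w)) =
    (fun k => fine (fubini_F P (fun z : R * T => (1 + cos (z.1 * X z.2))%:E) k) - 1).
  apply/funext => k; rewrite -[fine _]/(\int[P]_w (1 + cos (k * X w))).
  rewrite RintegralD//; last by apply: (integrable_bounded P (cst 1) 1) => // w; rewrite normr1.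
  rewrite Rintegral_cst// [X in 1 * fine X](_ : _ = 1%E); last exact: probability_setT.
  by rewrite /= mulr1 addrAC subrr add0r.
by apply: measurable_funB => //; apply: measurableT_comp.
Qed.

Lemma cf_le1 k : `|phi k| <= 1.
Proof.
rewrite -cos_phi; apply: (le_trans (le_normr_Rintegral _ (icos k))) => //.
apply: (@le_trans _ _ (\int[P]_w 1)).
  apply: le_Rintegral => //.
  - by apply: (integrable_bounded P _ 1) => [|w]; [exact: measurableT_comp|rewrite normr_id cos_max].
  - by apply: (integrable_bounded P (cst 1) 1) => // w; rewrite normr1.
  - by move=> w _; exact: cos_max.
by rewrite Rintegral_cst// [X in 1 * fine X](_ : _ = 1%E) ?mulr1//; exact: probability_setT.
Qed.

Variables (e : R).
Hypothesis e_gt0 : 0 < e.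

Let denom_gt0 (z : R) : 0 < e ^+ 2 + z ^+ 2.
Proof. by rewrite ltr_wpDr ?sqr_ge0// exprn_gt0. Qed.

(** A Parseval identity. The left side is [2 pi] times the density at [y] of [X] plus an independent
    Cauchy variable of scale [e]; the damping makes Fubini legitimate for the possibly
    non-integrable [phi]. *)
Lemma expectation_cauchy_kernel y :
  \int[P]_w (2 * e / (e ^+ 2 + (X w - y) ^+ 2)) =
  \int[mu]_k (expR (- (e * `|k|)) * phi k * cos (k * y)).
Proof.
under eq_Rintegral do rewrite -cauchy_kernelE//.
pose f (z : T * R) := expR (- (e * `|z.2|)) * cos (z.2 * (X z.1 - y)).
rewrite (Rintegral_fubini P mu f (cst 1) (fun k => expR (- (e * `|k|))))//.
- apply: eq_Rintegral => k _; rewrite /f/= RintegralZl//.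
    by rewrite expectation_cos_shift mulrA.
  apply: (integrable_bounded P _ 1) => [|w]; last exact: cos_max.
  apply: (measurableT_comp measurable_cos); apply: measurable_funM => //.
  exact: measurable_funB.
- apply: measurable_funM.
    apply: (measurableT_comp (f := fun k : R => expR (- (e * `|k|)))) => //.
    exact: measurable_expRN_norm.
  apply: (measurableT_comp measurable_cos); apply: measurable_funM => //.
  by apply: measurable_funB => //; exact: measurableT_comp.
- by apply: (integrable_bounded P (cst 1) 1) => // w; rewrite normr1.
- exact: integrable_expRN_norm.
- move=> w k; rewrite mul1r normrM ger0_norm ?expR_ge0//.
  by rewrite ler_piMr ?expR_ge0// cos_max.
Qed.

Let kernel_le z : 2 * e / (e ^+ 2 + z ^+ 2) <= 2 / e.
Proof.
rewrite ler_pdivrMr// mulrAC ler_pdivlMr// -mulrA -expr2.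
by rewrite ler_wpM2l// lerDl sqr_ge0.
Qed.

Let continuous_kernel (x : R) : continuous (fun y => 2 * e / (e ^+ 2 + (x - y) ^+ 2)).
Proof.
move=> y; apply: cvgM; first exact: cvg_cst.
apply: cvgV; first by rewrite gt_eqF.
apply: cvgD; first exact: cvg_cst.
by apply: cvgM; apply: cvgB; [exact: cvg_cst|exact: cvg_id|exact: cvg_cst|exact: cvg_id].
Qed.

Lemma integral_cauchy_kernel_le_2pi (x a b : R) : a <= b ->
  \int[mu]_(y in `[a, b]) (2 * e / (e ^+ 2 + (x - y) ^+ 2)) <= 2 * pi.
Proof.
move=> ab; have e0 : e != 0 by rewrite gt_eqF.
pose F y := 2 * atan ((y - x) / e).
have dF y : is_derive y (1 : R) F (2 * e / (e ^+ 2 + (x - y) ^+ 2)).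
  apply: is_derive_eq; rewrite /GRing.scale/=; field.
  by rewrite e0 andbT gt_eqF.
rewrite (FTC2_is_derive F _ _ _ ab dF)// /F.
have := atan_ltpi2 ((b - x) / e); have := atan_gtNpi2 ((a - x) / e); lra.
Qed.

Lemma integral_cauchy_kernel_outside (x a b del : R) : 0 < del -> a <= b ->
  ~~ (a - del < x < b + del) ->
  \int[mu]_(y in `[a, b]) (2 * e / (e ^+ 2 + (x - y) ^+ 2)) <=
  2 * e / del ^+ 2 * (b - a).
Proof.
move=> del0 ab xab.
apply: (@le_trans _ _ (\int[mu]_(y in `[a, b]) (2 * e / del ^+ 2))).
  apply: le_Rintegral => //.
  - by apply: integrable_continuous_itvcc; exact: continuous_kernel.
  - by apply: integrable_continuous_itvcc; exact: cst_continuous.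
  - move=> y /=; rewrite in_itv/= => /andP[ay yb].
    rewrite ler_pM2l ?mulr_gt0// lef_pV2 ?posrE ?exprn_gt0//.
    rewrite -[leLHS]add0r lerD ?sqr_ge0//.
    rewrite -[leRHS]real_normK ?num_real// ler_pXn2r ?nnegrE// ?(ltW del0)//.
    move: xab; rewrite negb_and -!leNgt => /orP[xa|xb].
      by rewrite ler0_norm; lra.
    by rewrite ger0_norm; lra.
rewrite Rintegral_cst// [X in _ * fine X](_ : _ = (b - a)%:E)//.
transitivity (lebesgue_measure (`[a, b]%classic : set R)) => //.
rewrite lebesgue_measure_itv/=; case: ifPn => [_|]; first by rewrite -EFinB.
by rewrite lte_fin -leNgt => ba; rewrite (@le_anti _ _ a b) ?ab// subrr.
Qed.

(* The kernel has mass [2 pi]; the last term bounds its contribution at distance [>= del]. *)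
Lemma smoothed_law_le (a b del : R) : 0 < del -> a <= b ->
  \int[mu]_(y in `[a, b]) \int[mu]_k (expR (- (e * `|k|)) * phi k * cos (k * y)) <=
  2 * pi * fine (P (X @^-1` `]a - del, b + del[)) + 2 * e / del ^+ 2 * (b - a).
Proof.
move=> del0 ab.
under eq_Rintegral do rewrite -expectation_cauchy_kernel.
pose c (z : R * T) := \1_(`[a, b]%classic) z.1 * (2 * e / (e ^+ 2 + (X z.2 - z.1) ^+ 2)).
pose A : set T := X @^-1` `]a - del, b + del[.
have mA : measurable A by rewrite -[A]setTI; exact: measurable_funP.
have kE (y x : R) : 2 * e / (e ^+ 2 + (0 - (y - x)) ^+ 2) = 2 * e / (e ^+ 2 + (x - y) ^+ 2).
  by rewrite sub0r opprB.
have mk : measurable_fun setT (fun z : R * T => 2 * e / (e ^+ 2 + (X z.2 - z.1) ^+ 2)).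
  rewrite (_ : (fun z => _) = (fun y => 2 * e / (e ^+ 2 + (0 - y) ^+ 2)) \o
      (fun z : R * T => z.1 - X z.2)); last by apply/funext => z; rewrite /= kE.
  apply: measurableT_comp.
    by apply: continuous_measurable_fun; exact: continuous_kernel.
  by apply: measurable_funB => //; exact: measurableT_comp.
have mc : measurable_fun setT c.
  by apply: measurable_funM => //; exact: measurableT_comp.
have k_ge0 z : 0 <= 2 * e / (e ^+ 2 + z ^+ 2).
  by rewrite divr_ge0// ?mulr_ge0// ltW.
have ik y : P.-integrable setT (EFin \o (fun w => 2 * e / (e ^+ 2 + (X w - y) ^+ 2))).
  apply: (integrable_bounded P _ (2 / e)) => [|w].
    exact: (measurableT_comp mk (measurable_pair1 y)).
  by rewrite ger0_norm.
have c_le y w : `|c (y, w)| <= \1_(`[a, b]%classic) y * (2 / e) * 1.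
  rewrite mulr1 /c/= ger0_norm; last by rewrite mulr_ge0.
  exact: ler_wpM2l.
have i1 : mu.-integrable setT (EFin \o (fun y => \1_(`[a, b]%classic) y * (2 / e))).
  rewrite (_ : _ \o _ = fun y => (2 / e)%:E * (\1_(`[a, b]%classic) y)%:E)%E.
    by apply: integrableZl => //; exact: integrable_indic_itv.
  by apply/funext => y; rewrite /= -EFinM mulrC.
have i2 : P.-integrable setT (EFin \o cst 1).
  by apply: (integrable_bounded P (cst 1) 1) => // w; rewrite normr1.
rewrite Rintegral_itv_indic.
rewrite (_ : \int[mu]_y _ = \int[P]_w \int[mu]_y c (y, w)); last first.
  rewrite -(Rintegral_fubini mu P c _ _ mc i1 i2 c_le); apply: eq_Rintegral => y _.
  by rewrite /c/= [RHS]RintegralZl.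
have lt_ab : a - del < b + del by lra.
pose C := 2 * e / del ^+ 2 * (b - a).
have C0 : 0 <= C by rewrite mulr_ge0 ?subr_ge0// divr_ge0 ?mulr_ge0 ?sqr_ge0// ltW.
have iA : P.-integrable setT (EFin \o (fun w => 2 * pi * \1_A w)).
  rewrite (_ : _ \o _ = fun y => (2 * pi)%:E * (\1_A y)%:E)%E//.
  by apply: integrableZl => //; exact: integrable_indic.
have iC : P.-integrable setT (EFin \o cst C).
  by apply: (integrable_bounded P (cst C) `|C|).
have fE w : \int[mu]_y c (y, w) = \int[mu]_(y in `[a, b]) (2 * e / (e ^+ 2 + (X w - y) ^+ 2)).
  by rewrite [RHS]Rintegral_itv_indic.
have f_le w : \int[mu]_y c (y, w) <= 2 * pi * \1_A w + C.
  rewrite fE indicE; have [wA|] := boolP (w \in A).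
    rewrite mulr1 (le_trans (integral_cauchy_kernel_le_2pi _ _ _ ab))//.
    by rewrite lerDl.
  rewrite mulr0 add0r => /negP wA; apply: integral_cauchy_kernel_outside => //.
  by apply/negP => H; apply: wA; rewrite inE /A/= in_itv/=.
have f_ge0 w : 0 <= \int[mu]_y c (y, w).
  by apply: Rintegral_ge0 => y _; rewrite mulr_ge0.
have if_ : P.-integrable setT (EFin \o (fun w => \int[mu]_y c (y, w))).
  apply: (integrable_bounded P _ (2 * pi + C)) => [|w].
    have : measurable_fun setT (fubini_G mu (EFin \o c)).
      apply: measurable_fun_fubini_tonelli_G; first exact/measurable_EFinP.
      by move=> z; rewrite lee_fin mulr_ge0.
    by move=> H; apply: measurableT_comp.
  rewrite ger0_norm// (le_trans (f_le w))// lerD2r.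
  by rewrite ler_piMr ?mulr_ge0 ?pi_ge0// indicE; case: (_ \in _).
apply: (@le_trans _ _ (\int[P]_w (2 * pi * \1_A w + C))).
  apply: le_Rintegral => //.
  rewrite (_ : EFin \o _ = (fun w => (2 * pi * \1_A w)%:E + (C)%:E)%E)//.
  exact: integrableD.
rewrite RintegralD// RintegralZl//; last exact: integrable_indic.
rewrite Rintegral_cst// [X in _ + C * fine X](_ : _ = 1%E); last exact: probability_setT.
by rewrite /= mulr1 lerD2r /Rintegral integral_indic// setIT.
Qed.

End smoothed_law.

End smoothing.

(** * From characteristic functions to distribution functions *)

Section continuity_theorem.
Context {R : realType}.
Notation mu := (@lebesgue_measure R).
Context {d} {T : measurableType d} {P : probability T R}.
Context {d'} {T' : measurableType d'} {P' : probability T' R}.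
Variables (X : nat -> {RV P >-> R}) (S : {RV P' >-> R}).
Variables (phi : nat -> R -> R) (psi g : R -> R).
Hypothesis cos_phi : forall n k, \int[P]_w cos (k * X n w) = phi n k.
Hypothesis sin_0 : forall n k, \int[P]_w sin (k * X n w) = 0.
Hypothesis phi_psi : forall k, phi n k @[n --> \oo] --> psi k.
Hypothesis ipsi : mu.-integrable setT (EFin \o psi).
Hypothesis g_psi : forall y, 2 * pi * g y = \int[mu]_k (psi k * cos (k * y)).
Hypothesis S_g : has_density S g.

Let mphi n : measurable_fun setT (phi n).
Proof. exact: (measurable_cf _ _ (cos_phi n)). Qed.

Let phi_le1 n k : `|phi n k| <= 1.
Proof. exact: (cf_le1 _ _ (cos_phi n)). Qed.

(** The order of the limits matters: [e] is fixed first, small enough for the damped integral of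
    [psi] to be near the undamped one and for the kernel mass leaking beyond distance [del] to be
    small, the latter uniformly in [n]. Only then does [n] grow. *)
Lemma liminf_open_itv (a b del eta : R) : a <= b -> 0 < del -> 0 < eta ->
  \forall n \near \oo, fine (P' (S @^-1` `[a, b])) - eta <
    fine (P (X n @^-1` `]a - del, b + del[)).
Proof.
move=> ab del0 eta0.
have pi0 : 0 < 2 * pi :> R by rewrite mulr_gt0// pi_gt0.
pose L := \int[mu]_(y in `[a, b]) \int[mu]_k (psi k * cos (k * y)).
have LE : fine (P' (S @^-1` `[a, b])) = L / (2 * pi).
  have -> : P' (S @^-1` `[a, b]) = (\int[mu]_(x in `[a, b]) (g x)%:E)%E.
    exact: S_g.
  rewrite -[LHS]/(\int[mu]_(x in `[a, b]) g x) /L.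
  have iL : mu.-integrable `[a, b] (EFin \o (fun y => \int[mu]_k (psi k * cos (k * y)))).
    apply: (integrable_cos_transform _ _ (fun k => `|psi k|)) => //.
      exact: integrable_norm.
    by apply/measurable_EFinP; exact: measurable_int ipsi.
  rewrite -RintegralZr//; apply: eq_Rintegral => y _.
  by rewrite -g_psi mulrAC divff ?mul1r// gt_eqF.
pose Le e := \int[mu]_(y in `[a, b]) \int[mu]_k (expR (- (e * `|k|)) * psi k * cos (k * y)).
pose Ln e n := \int[mu]_(y in `[a, b]) \int[mu]_k (expR (- (e * `|k|)) * phi n k * cos (k * y)).
have mexp e := measurable_expRN_norm e.
have Le_L : Le n.+1%:R^-1 @[n --> \oo] --> L.
  apply: (cvg_Rintegral_cos_transform _ _ (fun k => `|psi k|) _ _ psi) => //.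
  - exact: integrable_norm.
  - move=> n; apply: measurable_funM; first exact: mexp.
    by apply/measurable_EFinP; exact: measurable_int ipsi.
  - move=> k; rewrite -[X in _ --> X]mul1r; apply: cvgM; last exact: cvg_cst.
    have c0 : n.+1%:R^-1 * `|k| @[n --> \oo] --> (0 : R).
      by rewrite -(mul0r `|k|); apply: cvgM; [exact: cvg_harmonic|exact: cvg_cst].
    rewrite -[X in _ --> X]expR0 -oppr0.
    apply: (@continuous_cvg _ _ _ _ _ _ expR); first exact: continuous_expR.
    exact: cvgN.
  - by move=> n k; rewrite normrM ger0_norm ?expR_ge0// ler_piMl// -expR0 ler_expR oppr_le0 mulr_ge0.
have Ln_L e : 0 < e -> Ln e n @[n --> \oo] --> Le e.
  move=> e0; apply: (cvg_Rintegral_cos_transform _ _ (fun k => expR (- (e * `|k|))) _ (fun n k => expR (- (e * `|k|)) * phi n k)).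
  - exact: integrable_expRN_norm.
  - by move=> n; apply: measurable_funM; [exact: mexp|exact: mphi].
  - by move=> k; apply: cvgM; [exact: cvg_cst|exact: phi_psi].
  - by move=> n k; rewrite normrM ger0_norm ?expR_ge0// ler_piMr ?expR_ge0.
have Ln_le e n : 0 < e -> Ln e n <= 2 * pi * fine (P (X n @^-1` `]a - del, b + del[)) +
    2 * e / del ^+ 2 * (b - a).
  by move=> e0; exact: smoothed_law_le (cos_phi n) (sin_0 n) _ e0 _ _ _ del0 ab.
(* Three errors share [eta]: removal of the damping, convergence in [n], and leakage of the kernel.
   The factor [2 pi] appears because the integrals estimate [2 pi] times probabilities. *)
pose eta' := 2 * pi * eta / 3.
have eta'0 : 0 < eta' by rewrite divr_gt0// mulr_gt0.
have small : 2 * n.+1%:R^-1 / del ^+ 2 * (b - a) @[n --> \oo] --> (0 : R).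
  rewrite -(mul0r (b - a)); apply: cvgM; last exact: cvg_cst.
  rewrite -(mul0r (del ^- 2)); apply: cvgM; last exact: cvg_cst.
  rewrite -(mulr0 2); apply: cvgM; first exact: cvg_cst.
  exact: cvg_harmonic.
have [m [H1 H2]] : exists m : nat, `|L - Le m.+1%:R^-1| < eta' /\
    `|0 - 2 * m.+1%:R^-1 / del ^+ 2 * (b - a)| < eta'.
  have /cvgrPdist_lt/(_ _ eta'0) := Le_L.
  have /cvgrPdist_lt/(_ _ eta'0) := small.
  move=> [N1 _ N1P] [N2 _ N2P]; exists (maxn N1 N2); split.
    by apply: N2P; rewrite /= leq_maxr.
  by apply: N1P; rewrite /= leq_maxl.
have m0 : 0 < m.+1%:R^-1 :> R by rewrite invr_gt0.
have /cvgrPdist_lt/(_ _ eta'0) := Ln_L _ m0.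
apply: filterS => n H3.
have := Ln_le _ n m0; rewrite LE.
move: H1 H2 H3; rewrite !ltr_norml sub0r => /andP[_ H1] /andP[H2 _] /andP[_ H3] H4.
rewrite -(ltr_pM2l pi0) mulrBr mulrCA divff ?gt_eqF// mulr1.
have eta'E : 2 * pi * eta = 3 * eta' by rewrite /eta'; field.
rewrite eta'E; move: H1 H2 H3 H4.
set p := fine _; set u := 2 * _ / _ * _; set l1 := Le _; set l2 := Ln _ _; set q := 2 * pi * p.
clearbody p u l1 l2 q L eta' => {Le_L Ln_L}.
lra.
Qed.

Let mpre (X0 : {RV P >-> R}) (A : set R) : measurable A -> measurable (X0 @^-1` A).
Proof. by move=> mA; rewrite -[X in measurable X]setTI; exact: measurable_funP. Qed.

Let mpreS (A : set R) : measurable A -> measurable (S @^-1` A).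
Proof. by move=> mA; rewrite -[X in measurable X]setTI; exact: measurable_funP. Qed.

Let approx_inner (A : set R) (a b : nat -> R) (eta : R) : measurable A ->
  (forall n m, (n <= m)%N -> a m <= a n) -> (forall n m, (n <= m)%N -> b n <= b m) ->
  A = \bigcup_n `[a n, b n]%classic -> 0 < eta ->
  \forall n \near \oo, fine (P' (S @^-1` A)) - eta < fine (P' (S @^-1` `[a n, b n])).
Proof.
move=> mA da ib AE eta0.
have : P' (S @^-1` `[a n, b n]) @[n --> \oo] --> P' (S @^-1` A).
  rewrite AE preimage_bigcup; apply: nondecreasing_cvg_mu.
  - by move=> n; apply: mpreS.
  - by rewrite -preimage_bigcup -AE; exact: mpreS.
  - move=> n m nm; apply/subsetPset => w /=; rewrite !in_itv/= => /andP[H1 H2].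
    by rewrite (le_trans (da _ _ nm))//= (le_trans H2)// ib.
have -> : P' (S @^-1` A) = (fine (P' (S @^-1` A)))%:E.
  by rewrite fineK// fin_num_measure//; exact: mpreS.
move=> /fine_cvg/cvgrPdist_lt/(_ _ eta0); apply: filterS => n /=.
by rewrite ltr_norml => /andP[_]; rewrite ltrBlDr ltrBlDl addrC => ->.
Qed.

Lemma cvg_cdf x : cdf (X n) x @[n --> \oo] --> cdf S x.
Proof.
pose L : set R := `]-oo, x[%classic; pose Lx : set R := `]-oo, x]%classic.
pose U : set R := `]x, +oo[%classic.
have mL : measurable L by exact: measurable_itv.
have mLx : measurable Lx by exact: measurable_itv.
have mU : measurable U by exact: measurable_itv.
have UE : U = ~` Lx.
  by apply/seteqP; split => y; rewrite /U /Lx /= !in_itv/= ?andbT ltNge => /negP.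
have fin (A : set R) : measurable A -> P' (S @^-1` A) \is a fin_num.
  by move=> mA; rewrite fin_num_measure//; exact: mpreS.
have finX n (A : set R) : measurable A -> P (X n @^-1` A) \is a fin_num.
  by move=> mA; rewrite fin_num_measure//; exact: mpre.
have P'L : P' (S @^-1` Lx) = P' (S @^-1` L).
  have -> : Lx = L `|` [set x].
    apply/seteqP; split => y; rewrite /L /Lx /= !in_itv/=.
      by rewrite le_eqVlt => /orP[/eqP|]; [right|left].
    by case=> [/ltW//|->].
  rewrite preimage_setU measureU//; [|exact: mpreS..|].
    rewrite [X in (_ + X)%E](_ : _ = 0%E) ?adde0//.
    transitivity (\int[mu]_(y in [set x]) (g y)%:E)%E; first exact: S_g.
    by rewrite integral_set1.
  apply/seteqP; split => // w [Lw xw]; move: Lw.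
  by rewrite /L /= in_itv/= xw ltxx.
have invn_lt e : 0 < e -> \forall n \near \oo, (n.+1%:R^-1 : R) < e.
  by move=> e0; have := near_infty_natSinv_lt (PosNum e0).
have le_invn n m : (n <= m)%N -> (m.+1%:R^-1 : R) <= n.+1%:R^-1.
  by move=> nm; rewrite lef_pV2 ?posrE// ler_nat.
have invn_gt0 n : 0 < n.+1%:R^-1 :> R by rewrite invr_gt0.
(* The intervals keep the distance [1 / (n + 1)] from the cut [x]. The same quantity later serves as
   [del], so the enlarged open interval still lies inside the half-line. *)
have LE : L = \bigcup_n `[- n%:R, x - n.+1%:R^-1]%classic.
  apply/seteqP; split => [y|y [n _]]; rewrite /L/= !in_itv/=; last first.
    by move=> /andP[_ /le_lt_trans]; apply; rewrite ltrBlDr ltrDl.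
  move=> yx; have xy0 : 0 < x - y by rewrite subr_gt0.
  near \oo => n; exists n => //; rewrite /= in_itv/=.
  have H1 : - y <= n%:R by near: n; exact: nbhs_infty_ger.
  have H2 : n.+1%:R^-1 < x - y by near: n; exact: invn_lt.
  by rewrite lerNl H1/= lerBrDl -lerBrDr ltW.
have U_E : U = \bigcup_n `[x + n.+1%:R^-1, n%:R]%classic.
  apply/seteqP; split => [y|y [n _]]; rewrite /U/= !in_itv/= ?andbT; last first.
    by move=> /andP[+ _]; apply: lt_le_trans; rewrite ltrDl.
  move=> yx; have xy0 : 0 < y - x by rewrite subr_gt0.
  near \oo => n; exists n => //; rewrite /= in_itv/=.
  have H1 : y <= n%:R by near: n; exact: nbhs_infty_ger.
  have H2 : n.+1%:R^-1 < y - x by near: n; exact: invn_lt.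
  by rewrite H1 andbT -lerBrDl ltW.
rewrite /cdf /distribution /= /pushforward.
have -> : P' (S @^-1` `]-oo, x]) = (fine (P' (S @^-1` Lx)))%:E by rewrite fineK ?fin.
apply: cvg_EFin; first by apply: nearW => n; exact: finX.
apply/cvgrPdist_lt => e e0.
(* One half of [e] pays for replacing a half-line by a bounded interval, the other half for
   [liminf_open_itv]. *)
have e20 : 0 < e / 2 by rewrite divr_gt0.
near \oo => N.
have N1 : 1 - x <= N%:R by near: N; exact: nbhs_infty_ger.
have N2 : x + 1 <= N%:R by near: N; exact: nbhs_infty_ger.
have iN1 : N.+1%:R^-1 <= 1 :> R by rewrite invf_le1// ler1n.
have iN0 := invn_gt0 N.
have ab1 : - N%:R <= x - N.+1%:R^-1.
  by rewrite lerNl opprB (le_trans _ N1)// lerD2r.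
have ab2 : x + N.+1%:R^-1 <= N%:R by rewrite (le_trans _ N2)// lerD2l.
have HL : fine (P' (S @^-1` L)) - e / 2 < fine (P' (S @^-1` `[- N%:R, x - N.+1%:R^-1])).
  near: N; apply: approx_inner => //.
    by move=> n m nm; rewrite lerN2 ler_nat.
  by move=> n m nm; rewrite lerD2l lerN2 le_invn.
have HU : fine (P' (S @^-1` U)) - e / 2 < fine (P' (S @^-1` `[x + N.+1%:R^-1, N%:R])).
  near: N; apply: approx_inner => //.
    by move=> n m nm; rewrite lerD2l le_invn.
  by move=> n m nm; rewrite ler_nat.
near=> n.
have H1 : fine (P' (S @^-1` `[- N%:R, x - N.+1%:R^-1])) - e / 2 <
    fine (P (X n @^-1` `]- N%:R - N.+1%:R^-1, x - N.+1%:R^-1 + N.+1%:R^-1[)).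
  by near: n; exact: liminf_open_itv.
have H2 : fine (P' (S @^-1` `[x + N.+1%:R^-1, N%:R])) - e / 2 <
    fine (P (X n @^-1` `]x + N.+1%:R^-1 - N.+1%:R^-1, N%:R + N.+1%:R^-1[)).
  by near: n; exact: liminf_open_itv.
have K1 : fine (P (X n @^-1` `]- N%:R - N.+1%:R^-1, x - N.+1%:R^-1 + N.+1%:R^-1[)) <=
    fine (P (X n @^-1` Lx)).
  rewrite fine_le ?finX// le_measure ?inE; [by []|by apply: mpre|by apply: mpre|].
  by move=> w; rewrite /Lx /= !in_itv/= subrK => /andP[_ /ltW].
have K2 : fine (P (X n @^-1` `]x + N.+1%:R^-1 - N.+1%:R^-1, N%:R + N.+1%:R^-1[)) <=
    fine (P (X n @^-1` U)).
  rewrite fine_le ?finX// le_measure ?inE; [by []|by apply: mpre|by apply: mpre|].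
  by move=> w; rewrite /U /= !in_itv/= addrK andbT => /andP[].
have C1 : fine (P (X n @^-1` U)) = 1 - fine (P (X n @^-1` Lx)).
  rewrite UE preimage_setC probability_setC; last exact: mpre mLx.
  by rewrite fineB//; exact: finX mLx.
have C2 : fine (P' (S @^-1` U)) = 1 - fine (P' (S @^-1` Lx)).
  rewrite UE preimage_setC probability_setC; last exact: mpreS mLx.
  by rewrite fineB//; exact: fin mLx.
rewrite -P'L in HL.
rewrite /= -[X in `|_ - X|]/(fine (P (X n @^-1` Lx))) ltr_norml.
move: HL HU H1 H2 K1 K2; rewrite C1 C2.
move: (fine _) (fine _) (fine _) (fine _) (fine _) (fine _) => a1 a2 a3 a4 a5 a6.
by move=> *; apply/andP; split; lra.
Unshelve. all: by end_near. Qed.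

End continuity_theorem.

(** * The series of [(1 - cos (k theta)) / k^3] *)

Section trigonometric_bounds.
Context {R : realType}.

Lemma is_derive_ge0_le (F f : R -> R) a b :
  (forall x, is_derive x (1 : R) F (f x)) -> (forall x, a <= x -> 0 <= f x) ->
  a <= b -> F a <= F b.
Proof.
move=> dF f0 ab.
have cF : continuous F by apply: derivable_continuous => x; apply: ex_derive.
apply: (@ger0_derive1_le_cc _ F a b) => //.
- by move=> x /itvP H; rewrite derive1E derive_val f0// H.
- exact: continuous_subspaceT.
- by rewrite in_itv/= lexx.
- by rewrite in_itv/= ab lexx.
Qed.

(** Start of a chain of Taylor bounds ending at degree 4: each difference vanishes at [0] and has
    the preceding difference as derivative. *)
Lemma sin_le_id (x : R) : 0 <= x -> sin x <= x.
Proof.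
move=> x0; have dF y : is_derive y (1 : R) (fun y => y - sin y) (1 - cos y).
  exact: is_derive_eq.
have := is_derive_ge0_le _ _ _ _ dF _ x0.
rewrite /= sin0 subrr subr_ge0; apply => y _.
by rewrite subr_ge0 cos_le1.
Qed.

Let cos_ge_quadratic0 (x : R) : 0 <= x -> 1 - x ^+ 2 / 2 <= cos x.
Proof.
move=> x0; have dF y : is_derive y (1 : R) (fun y => cos y - 1 + y ^+ 2 / 2) (y - sin y).
  by apply: is_derive_eq; rewrite /GRing.scale/=; field.
have := is_derive_ge0_le _ _ _ _ dF _ x0.
rewrite /= cos0 => H; suff: 1 - 1 + 0 ^+ 2 / 2 <= cos x - 1 + x ^+ 2 / 2 by lra.
by apply: H => y y0; rewrite subr_ge0 sin_le_id.
Qed.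

Lemma cos_ge_quadratic (x : R) : 1 - x ^+ 2 / 2 <= cos x.
Proof. by rewrite -cos_norm -real_normK ?num_real//; exact: cos_ge_quadratic0. Qed.

Let sin_ge_cubic (x : R) : 0 <= x -> x - x ^+ 3 / 6 <= sin x.
Proof.
move=> x0; have dF y : is_derive y (1 : R) (fun y => sin y - y + y ^+ 3 / 6)
    (cos y - 1 + y ^+ 2 / 2).
  by apply: is_derive_eq; rewrite /GRing.scale/=; field.
have := is_derive_ge0_le _ _ _ _ dF _ x0.
rewrite /= sin0 => H; suff: 0 - 0 + 0 ^+ 3 / 6 <= sin x - x + x ^+ 3 / 6 by lra.
by apply: H => y y0; have := cos_ge_quadratic y; lra.
Qed.

Let cos_le_quartic0 (x : R) : 0 <= x -> cos x <= 1 - x ^+ 2 / 2 + x ^+ 4 / 24.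
Proof.
move=> x0; have dF y : is_derive y (1 : R) (fun y => 1 - y ^+ 2 / 2 + y ^+ 4 / 24 - cos y)
    (sin y - y + y ^+ 3 / 6).
  by apply: is_derive_eq; rewrite /GRing.scale/=; field.
have := is_derive_ge0_le _ _ _ _ dF _ x0.
rewrite /= cos0 => H.
suff: 1 - 0 ^+ 2 / 2 + 0 ^+ 4 / 24 - 1 <= 1 - x ^+ 2 / 2 + x ^+ 4 / 24 - cos x by lra.
by apply: H => y y0; have := sin_ge_cubic _ y0; lra.
Qed.

Lemma cos_le_quartic (x : R) : cos x <= 1 - x ^+ 2 / 2 + x ^+ 4 / 24.
Proof.
rewrite -cos_norm (_ : x ^+ 4 = (x ^+ 2) ^+ 2); last by rewrite -exprM.
by rewrite -[x ^+ 2]real_normK ?num_real// -exprM; exact: cos_le_quartic0.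
Qed.

End trigonometric_bounds.

Section cubic_series.
Context {R : realType}.
Implicit Types (theta : R) (N : nat).

Let harmonic_sum N : R := \sum_(i < N) i.+1%:R^-1.

Let ln_le_harmonic_sum N : ln N.+1%:R <= harmonic_sum N.
Proof.
elim: N => [|N IH]; first by rewrite ln1 /harmonic_sum big_ord0.
rewrite /harmonic_sum big_ord_recr/= -/(harmonic_sum N).
have -> : N.+2%:R = N.+1%:R * (1 + N.+1%:R^-1) :> R.
  by rewrite mulrDr mulr1 divff ?pnatr_eq0// -natr1.
rewrite lnM ?posrE ?addr_gt0 ?invr_gt0// lerD// le_ln1Dx//.
by rewrite (@lt_trans _ _ 0) ?invr_gt0// ltrN10.
Qed.

Let harmonic_sum_le N : harmonic_sum N.+1 <= 1 + ln N.+1%:R.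
Proof.
elim: N => [|N IH]; first by rewrite ln1 /harmonic_sum big_ord_recr big_ord0/= invr1 add0r addr0.
rewrite /harmonic_sum big_ord_recr/= -/(harmonic_sum N.+1).
rewrite (le_trans (lerD IH (lexx _)))// -addrA lerD2l.
have E : N.+1%:R = N.+2%:R * (1 - N.+2%:R^-1) :> R.
  by rewrite mulrBr mulr1 divff ?pnatr_eq0// -[N.+2%:R]natr1 addrK.
have lt1 : N.+2%:R^-1 < 1 :> R by rewrite invf_lt1// ltr1n.
have := @le_ln1Dx R (- N.+2%:R^-1); rewrite ltrN2 => /(_ lt1).
rewrite E lnM ?posrE ?subr_gt0//.
have aux (x y z : R) : x <= - z -> y + x + z <= y by lra.
exact: aux.
Qed.

Definition cubic_term theta (i : nat) : R := i.+1%:R ^- 3 * (1 - cos (theta * i.+1%:R)).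

Lemma cubic_term_ge0 theta i : 0 <= cubic_term theta i.
Proof. by rewrite mulr_ge0 ?invr_ge0 ?exprn_ge0// subr_ge0 cos_le1. Qed.

Let cubic_term_le_small theta i : cubic_term theta i <= theta ^+ 2 / 2 * i.+1%:R^-1.
Proof.
have k0 : 0 < i.+1%:R :> R by [].
have := cos_ge_quadratic (theta * i.+1%:R); rewrite /cubic_term.
move: (cos _) k0 => c; move: (i.+1%:R : R) => k k0 H.
have -> : theta ^+ 2 / 2 * k^-1 = k ^- 3 * ((theta * k) ^+ 2 / 2).
  by field; rewrite gt_eqF.
by rewrite ler_wpM2l ?invr_ge0 ?exprn_ge0 ?(ltW k0)//; lra.
Qed.

Let cubic_term_ge theta i :
  theta ^+ 2 / 2 * i.+1%:R^-1 - theta ^+ 4 / 24 * i.+1%:R <= cubic_term theta i.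
Proof.
have k0 : 0 < i.+1%:R :> R by [].
have := cos_le_quartic (theta * i.+1%:R); rewrite /cubic_term.
move: (cos _) k0 => c; move: (i.+1%:R : R) => k k0 H.
have -> : theta ^+ 2 / 2 * k^-1 - theta ^+ 4 / 24 * k =
    k ^- 3 * ((theta * k) ^+ 2 / 2 - (theta * k) ^+ 4 / 24).
  by field; rewrite gt_eqF.
by rewrite ler_wpM2l ?invr_ge0 ?exprn_ge0 ?(ltW k0)//; lra.
Qed.

(** Bounding [1 - cos] by 2 leaves [2 / (k + 1)^3], which is at most twice the increment of
    [- 1 / k^2]; the sum then telescopes. *)
Let cubic_term_tail theta i :
  cubic_term theta i.+1 <= 2 * (i.+1%:R ^- 2 - i.+2%:R ^- 2).
Proof.
rewrite /cubic_term -[i.+2%:R]natr1.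
have k0 : 0 < i.+1%:R :> R by [].
have : 1 - cos (theta * (i.+1%:R + 1)) <= 2.
  by have := cos_geN1 (theta * (i.+1%:R + 1)); lra.
move: (1 - cos _) k0 => c; move: (i.+1%:R : R) => k k0 H.
have k1 : 0 < k + 1 by lra.
apply: (@le_trans _ _ ((k + 1) ^- 3 * 2)).
  by rewrite ler_wpM2l ?invr_ge0 ?exprn_ge0// ltW.
rewrite -subr_ge0 (_ : _ - _ = 2 * (2 * k ^+ 2 + 3 * k + 1 - k ^+ 2) / (k ^+ 2 * (k + 1) ^+ 3)).
  rewrite divr_ge0 ?mulr_ge0 ?exprn_ge0 ?ltW//; nra.
by field; rewrite !gt_eqF.
Qed.

Let cubic_sum theta N : R := \sum_(i < N) cubic_term theta i.

Let sum_cubic_tail theta N M :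
  cubic_sum theta (N.+1 + M) <= cubic_sum theta N.+1 + 2 * (N.+1%:R ^- 2 - (N.+1 + M)%:R ^- 2).
Proof.
elim: M => [|M IH]; first by rewrite addn0 subrr mulr0 addr0.
rewrite addnS /cubic_sum big_ord_recr/= -/(cubic_sum _ _).
rewrite (le_trans (lerD IH (cubic_term_tail theta (N + M))))//.
by rewrite addSn -addrA lerD2l -mulrDr addrA subrK.
Qed.

(* The terms with [k <= 1 / theta] are compared with a harmonic sum, the others telescope. *)
Lemma cubic_sum_le theta M : 0 < theta <= 1 ->
  \sum_(i < M) cubic_term theta i <= theta ^+ 2 / 2 * ln theta^-1 + 9 * theta ^+ 2.
Proof.
move=> /andP[t0 t1]; rewrite -/(cubic_sum theta M).
have it1 : 1 <= theta^-1 by rewrite invf_ge1.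
have [N [N1 N2]] : exists N : nat, N.+1%:R <= theta^-1 /\ theta^-1 < N.+2%:R.
  have /andP[H1 H2] := truncn_itv (le_trans ler01 it1).
  have := it1; rewrite -truncn_gt0; case E : (Num.Def.trunc _) => [//|N] _.
  by exists N; rewrite -E.
have sumN : cubic_sum theta N.+1 <= theta ^+ 2 / 2 * (1 + ln theta^-1).
  apply: (@le_trans _ _ (theta ^+ 2 / 2 * harmonic_sum N.+1)).
    by rewrite /harmonic_sum mulr_sumr; apply: ler_sum => i _; exact: cubic_term_le_small.
  rewrite ler_wpM2l ?divr_ge0 ?sqr_ge0// (le_trans (harmonic_sum_le N))// lerD2l.
  by rewrite ler_ln ?posrE// invr_gt0.
have N0 : 0 < N.+1%:R :> R by [].
(* As [1 / theta < N + 2 <= 2 (N + 1)], the telescoped tail costs at most [2 * 4 theta^2]; the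
   constant 1 in the harmonic bound costs another [theta^2 / 2]. Hence the 9 of the statement. *)
have iN : N.+1%:R ^- 2 <= 4 * theta ^+ 2.
  have : N.+1%:R^-1 <= 2 * theta.
    rewrite -[2 * theta]invrK lef_pV2 ?posrE ?invr_gt0 ?mulr_gt0// invfM.
    have : (N.+2%:R : R) <= 2 * N.+1%:R by rewrite -natrM ler_nat mulnS mul2n -addnn; lia.
    by move=> H; rewrite mulrC ler_pdivrMr// [leRHS]mulrC (le_trans (ltW N2)).
  rewrite -exprVn (_ : 4 * theta ^+ 2 = (2 * theta) ^+ 2); last by ring.
  by move=> H; rewrite lerXn2r ?nnegrE// ?invr_ge0// mulr_ge0// ltW.
apply: (@le_trans _ _ (cubic_sum theta (N.+1 + M))).
  rewrite /cubic_sum addnC big_split_ord/= lerDl.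
  by apply: sumr_ge0 => i _; exact: cubic_term_ge0.
rewrite (le_trans (sum_cubic_tail _ _ _))//.
have : 0 <= (N.+1 + M)%:R ^- 2 :> R by rewrite invr_ge0 exprn_ge0.
move: sumN iN (sqr_ge0 theta).
move: (cubic_sum _ _) (_ ^- 2) (_ ^- 2) (ln _) => a b c l; lra.
Qed.

(** The terms being nonnegative, a single partial sum bounds the series from below. With [N] the
    integer part of [1 / theta], the quartic Taylor errors add up to at most
    [theta^4 N^2 / 24 <= theta^2 / 24]. *)
Lemma cubic_sum_ge theta : 0 < theta <= 1 ->
  exists N, theta ^+ 2 / 2 * ln theta^-1 - theta ^+ 2 <= \sum_(i < N) cubic_term theta i.
Proof.
move=> /andP[t0 t1].
have it1 : 1 <= theta^-1 by rewrite invf_ge1.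
have /andP[N1 N2] := truncn_itv (le_trans ler01 it1).
set N := Num.Def.trunc _ in N1 N2.
exists N; apply: (@le_trans _ _ (\sum_(i < N)
    (theta ^+ 2 / 2 * i.+1%:R^-1 - theta ^+ 4 / 24 * N%:R))); last first.
  apply: ler_sum => i _; apply: le_trans (cubic_term_ge theta i).
  rewrite lerD2l lerN2 ler_wpM2l ?divr_ge0 ?exprn_ge0 ?(ltW t0)//.
  by rewrite ler_nat.
rewrite big_split/= sumr_const card_ord -mulr_sumr -/(harmonic_sum N) lerD//.
  rewrite ler_wpM2l ?divr_ge0 ?sqr_ge0// (le_trans _ (ln_le_harmonic_sum N))//.
  by rewrite ler_ln ?posrE ?invr_gt0// ltW.
rewrite mulNrn lerN2 -[_ *+ N]mulr_natr.
have tN : theta * N%:R <= 1 by rewrite mulrC -ler_pdivlMr// mul1r.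
have tN0 : 0 <= theta * N%:R by rewrite mulr_ge0// ltW.
have -> : theta ^+ 4 / 24 * N%:R * N%:R = theta ^+ 2 * ((theta * N%:R) ^+ 2 / 24).
  by field.
by rewrite ler_piMr ?sqr_ge0//; move: (theta * _) tN tN0 => x; nra.
Qed.

Lemma cubic_series_asymptotics theta D : 0 < theta <= 1 ->
  D%:E = (\sum_(i <oo) (cubic_term theta i)%:E)%E ->
  `|D - theta ^+ 2 / 2 * ln theta^-1| <= 9 * theta ^+ 2.
Proof.
move=> t01 DE.
have ge0 i : (0 <= (cubic_term theta i)%:E)%E by rewrite lee_fin cubic_term_ge0.
have DU : D <= theta ^+ 2 / 2 * ln theta^-1 + 9 * theta ^+ 2.
  rewrite -lee_fin DE; apply: lime_le; first exact: is_cvg_nneseries.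
  by apply: nearW => n; rewrite sumEFin lee_fin big_mkord cubic_sum_le.
have [N HN] := cubic_sum_ge theta t01.
have DL : \sum_(i < N) cubic_term theta i <= D.
  by rewrite -lee_fin DE -sumEFin -(big_mkord predT (fun i => (cubic_term theta i)%:E));
    exact: nneseries_lim_ge.
have := sqr_ge0 theta; rewrite ler_norml; move: DU DL HN.
move: (ln _) (theta ^+ 2) (\sum_(_ < _) _) => l u v; lra.
Qed.

End cubic_series.

(** * The integral of [v^(al-1) / (1 + v^2)] *)

Lemma measurable_fun_invr {R : realType} {d} {T : measurableType d} (D : set T)
    (f : T -> R) : measurable D -> (forall x, D x -> 0 <= f x) ->
  measurable_fun D f -> measurable_fun D (fun x => (f x)^-1).
Proof.
move=> mD f0 mf; apply: (eq_measurable_fun (fun x => f x `^ (-1))).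
  by move=> x /set_mem Dx; rewrite powR_inv1// f0.
by apply: (measurableT_comp (f := fun y : R => y `^ (-1))).
Qed.

(** * Finite sums and geometric expansions under the integral *)

Section Rintegral_sum.
Context {R : realType} {d} {T : measurableType d}.
Variables (mu : {measure set T -> \bar R}) (D : set T).
Hypothesis mD : measurable D.

Lemma integrable_sum_ord (f : nat -> T -> R) n :
  (forall i, mu.-integrable D (EFin \o f i)) ->
  mu.-integrable D (EFin \o (fun x => \sum_(i < n) f i x)).
Proof.
move=> fi; elim: n => [|n IH].
  rewrite (_ : _ \o _ = cst 0%E); first exact: integrable0.
  by apply/funext => x /=; rewrite big_ord0.
apply: eq_integrable (integrableD mD IH (fi n)) => // x _ /=.
by rewrite big_ord_recr.
Qed.

Lemma Rintegral_sum_ord (f : nat -> T -> R) n :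
  (forall i, mu.-integrable D (EFin \o f i)) ->
  \int[mu]_(x in D) (\sum_(i < n) f i x) = \sum_(i < n) \int[mu]_(x in D) f i x.
Proof.
move=> fi; elim: n => [|n IH].
  under eq_Rintegral do rewrite big_ord0.
  by rewrite big_ord0 Rintegral_cst// mul0r.
under eq_Rintegral do rewrite big_ord_recr/=.
by rewrite big_ord_recr/= -IH RintegralD//; exact: integrable_sum_ord.
Qed.

(** The remainder of the finite geometric sum is [rho^M / (1 + rho)] up to sign, so the expansion
    stays valid where [rho = 1], that is, up to the cut [v = 1]. It is applied with [rho = v^2]
    below the cut and [rho = v^-2] above it. *)
Lemma Rintegral_alternating_geometric (w rho : T -> R) M :
  measurable_fun D w -> measurable_fun D rho ->
  (forall x, D x -> 0 <= w x) -> (forall x, D x -> 0 <= rho x <= 1) ->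
  (forall n, mu.-integrable D (EFin \o (fun x => w x * rho x ^+ n))) ->
  mu.-integrable D (EFin \o (fun x => w x / (1 + rho x))) /\
  `|\int[mu]_(x in D) (w x / (1 + rho x)) -
    \sum_(n < M) (-1) ^+ n * \int[mu]_(x in D) (w x * rho x ^+ n)| <=
  \int[mu]_(x in D) (w x * rho x ^+ M).
Proof.
move=> mw mr w0 r01 iwr.
have i1 : mu.-integrable D (EFin \o (fun x => w x / (1 + rho x))).
  apply: (integrable_le mu D _ (fun x => w x * rho x ^+ 0)) => //.
    apply: measurable_funM => //; apply: measurable_fun_invr => //.
      by move=> x Dx; have /andP[] := r01 x Dx; lra.
    exact: measurable_funD.
  move=> x Dx; have /andP[r0 _] := r01 x Dx.
  rewrite expr0 mulr1 ger0_norm ?divr_ge0 ?w0 ?addr_ge0//.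
  by rewrite ler_pdivrMr ?ler_peMr ?w0//; lra.
split => //.
have i2 n : mu.-integrable D (EFin \o (fun x => (-1) ^+ n * (w x * rho x ^+ n))).
  rewrite (_ : _ \o _ = fun x => ((-1) ^+ n)%:E * (EFin \o (fun x => (w x * rho x ^+ n)%R)) x)%E//.
  exact: integrableZl.
under eq_bigr do rewrite -RintegralZl//.
rewrite -(Rintegral_sum_ord (fun n x => (-1) ^+ n * (w x * rho x ^+ n)))//.
have i3 := integrable_sum_ord _ M i2.
rewrite -RintegralB//.
have E x : D x -> w x / (1 + rho x) - \sum_(n < M) (-1) ^+ n * (w x * rho x ^+ n) =
    (-1) ^+ M * (w x * rho x ^+ M) / (1 + rho x).
  move=> Dx; have /andP[r0 _] := r01 x Dx.
  have r1 : 1 + rho x != 0 by rewrite gt_eqF//; lra.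
  under eq_bigr do rewrite mulrCA -exprMn mulN1r.
  rewrite -mulr_sumr mulrCA -exprMn mulN1r.
  have := subrX1 (- rho x) M; set s := \sum_(_ < _) _ => H.
  have -> : (- rho x) ^+ M = 1 - (1 + rho x) * s by rewrite -[LHS](subrK 1) H; ring.
  by field.
have i4 : mu.-integrable D (EFin \o (fun x => (-1) ^+ M * (w x * rho x ^+ M) / (1 + rho x))).
  apply: eq_integrable (integrableB mD i1 i3) => // x /set_mem Dx /=.
  by rewrite -E.
rewrite (@eq_Rintegral _ _ _ mu D (fun x => (-1) ^+ M * (w x * rho x ^+ M) / (1 + rho x))); last first.
  by move=> x /set_mem Dx; rewrite E.
apply: (le_trans (le_normr_Rintegral mD i4)).
apply: le_Rintegral => //; first exact: integrable_norm.
move=> x Dx; have /andP[r0 _] := r01 x Dx.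
have wr0 : 0 <= w x * rho x ^+ M by rewrite mulr_ge0 ?w0 ?exprn_ge0.
rewrite normrM normrM normrX normrN1 expr1n mul1r (ger0_norm wr0).
rewrite normfV ger0_norm ?addr_ge0// ler_pdivrMr; last lra.
by rewrite ler_peMr//; lra.
Qed.

End Rintegral_sum.

(** * Integrals of powers near zero and near infinity *)

Section power_integrals.
Context {R : realType}.
Notation mu := (@lebesgue_measure R).

Lemma continuous_powR_gt0 (p x : R) : 0 < x -> {for x, continuous (fun y => y `^ p)}.
Proof.
move=> x0; apply/differentiable_continuous/derivable1_diffP.
by apply: derivable_powR; rewrite in_itv/= x0.
Qed.

Let is_derive_primitive (p x : R) : p + 1 != 0 -> 0 < x ->
  is_derive x (1 : R) (fun y => y `^ (p + 1) / (p + 1)) (x `^ p).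
Proof.
move=> p1 x0; have H := @is_derive1_powR R (p + 1) x x0.
apply: is_derive_eq; rewrite /GRing.scale/= addrK; field.
exact: p1.
Qed.

Lemma integral_powR_01 (p : R) : -1 < p ->
  (\int[mu]_(x in `]0%R, 1%R]) (x `^ p)%:E = ((p + 1)^-1)%:E)%E.
Proof.
move=> p1; have p10 : 0 < p + 1 by lra.
have p1n : p + 1 != 0 by rewrite gt_eqF.
(* For negative [p] the integrand is singular at [0], so the interval is exhausted from the right.
   At [n = 0] the piece reduces to the point 1 and is treated apart from the fundamental theorem. *)
pose F (n : nat) : set R := `[n.+1%:R^-1, 1%R]%classic.
have UF : \bigcup_n F n = `]0, 1]%classic.
  apply/seteqP; split => [x [n _]|x]; rewrite /F /= !in_itv/=.
    by move=> /andP[nx ->]; rewrite andbT (lt_le_trans _ nx)// invr_gt0.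
  move=> /andP[x0 x1]; have [k kx] := ltr_add_invr x0.
  by exists k => //; rewrite /= in_itv/= x1 andbT; rewrite add0r in kx; exact: ltW.
have int_F n : (\int[mu]_(x in F n) (x `^ p)%:E =
    ((p + 1)^-1 - n.+1%:R^-1 `^ (p + 1) / (p + 1))%:E)%E.
  have n0 : 0 < n.+1%:R^-1 :> R by rewrite invr_gt0.
  have : n.+1%:R^-1 <= 1 :> R by rewrite invf_le1// ler1n.
  rewrite le_eqVlt => /predU1P[n1|n1].
    by rewrite /F n1 set_itv1 integral_set1 powR1 mul1r subrr.
  have cF x : 0 < x -> {for x, continuous (fun y => y `^ (p + 1) / (p + 1))}.
    by move=> x0; apply: cvgM; [exact: continuous_powR_gt0|exact: cvg_cst].
  rewrite /F (@continuous_FTC2 _ (fun x => x `^ p) (fun y => y `^ (p + 1) / (p + 1)))//.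
  - by rewrite powR1 mul1r -EFinB.
  - apply: continuous_in_subspaceT => x /set_mem; rewrite /= in_itv/= => /andP[nx _].
    by apply: continuous_powR_gt0; exact: lt_le_trans nx.
  - split.
    + move=> x; rewrite in_itv/= => /andP[nx _].
      by have [] := is_derive_primitive p x p1n (lt_trans n0 nx).
    + by apply: cvg_at_right_filter; exact: cF.
    + by apply: cvg_at_left_filter; apply: cF.
  - move=> x; rewrite in_itv/= => /andP[nx _]; rewrite derive1E.
    by have [_ ->] := is_derive_primitive p x p1n (lt_trans n0 nx).
have H1 : (\int[mu]_(x in F n) (x `^ p)%:E)%E @[n --> \oo] -->
    (\int[mu]_(x in `]0%R, 1%R]) (x `^ p)%:E)%E.
  rewrite -UF; apply: ge0_nondecreasing_set_cvg_integral => //.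
  - move=> n m nm; apply/subsetPset => x; rewrite /F /= !in_itv/= => /andP[nx ->].
    by rewrite andbT (le_trans _ nx)// lef_pV2 ?posrE// ler_nat.
  - by move=> n; exact: measurable_itv.
  - by move=> n; apply/measurable_EFinP/measurable_funTS; exact: measurable_powR.
  - by move=> n x _; rewrite lee_fin powR_ge0.
suff H2 : (\int[mu]_(x in F n) (x `^ p)%:E)%E @[n --> \oo] --> ((p + 1)^-1)%:E.
  exact: (cvg_unique _ H1 H2).
under eq_cvg do rewrite int_F.
apply: cvg_EFin; first exact: nearW.
rewrite -[X in _ --> X]subr0; apply: cvgB; first exact: cvg_cst.
rewrite -(mul0r (p + 1)^-1); apply: cvgM; last exact: cvg_cst.
apply: (@cvg_comp _ _ _ (fun n : nat => n.+1%:R^-1 : R) (fun x => x `^ (p + 1)) _ 0^'+).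
  move=> A [e e0 eA]; change (\forall n \near \oo, A (n.+1%:R^-1 : R)).
  near=> n; apply: eA; last first.
    by have : 0 < n.+1%:R^-1 :> R by rewrite invr_gt0.
  rewrite /= sub0r normrN gtr0_norm ?invr_gt0//.
  by near: n; exact: (near_infty_natSinv_lt (PosNum e0)).
exact: powR_cvg0.
Unshelve. all: by end_near. Qed.

Lemma integral_powR_1y (p : R) : p < -1 ->
  (\int[mu]_(x in `[1%R, +oo[) (x `^ p)%:E = (- (p + 1)^-1)%:E)%E.
Proof.
move=> p1; have p10 : p + 1 < 0 by lra.
have p1n : p + 1 != 0 by rewrite lt_eqF.
rewrite (@ge0_continuous_FTC2y _ (fun x => x `^ p) (fun y => y `^ (p + 1) / (p + 1)) _ 0).
- by rewrite powR1 mul1r sub0e.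
- by move=> x _; exact: powR_ge0.
- apply: continuous_in_subspaceT => x /set_mem; rewrite /= in_itv/= andbT => x1.
  by apply: continuous_powR_gt0; exact: lt_le_trans x1.
- rewrite -(mul0r (p + 1)^-1); apply: cvgM; last exact: cvg_cst.
  apply: (@cvg_trans _ (expR (- (- (p + 1) * ln x)) @[x --> +oo])).
    apply: near_eq_cvg; near=> x; rewrite /powR gt_eqF ?mulNr ?opprK//.
  apply: (@cvg_comp _ _ _ (fun x => - (p + 1) * ln x) (fun z => expR (- z)) _ (pinfty_nbhs R)).
    apply: gt0_cvgMry; first by lra.
    apply/cvgryPge => A; near=> x; have : expR A <= x by [].
    by rewrite -ler_ln ?posrE ?expR_gt0// expRK.
  exact: cvgr_expR.
- by move=> x x1; have [] := is_derive_primitive p x p1n (lt_trans ltr01 x1).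
- apply: cvg_at_right_filter; apply: cvgM; last exact: cvg_cst.
  by apply: continuous_powR_gt0.
- move=> x; rewrite in_itv/= andbT derive1E => x1.
  by have [_ ->] := is_derive_primitive p x p1n (lt_trans ltr01 x1).
Unshelve. all: by end_near. Qed.

End power_integrals.

(** * The integral as a limit of partial-fraction sums *)

Section stieltjes_power_integral.
Context {R : realType}.
Notation mu := (@lebesgue_measure R).
Variable al : R.
Hypothesis al02 : 0 < al < 2.

Let al0 : 0 < al. Proof. by have /andP[] := al02. Qed.
Let al2 : al < 2. Proof. by have /andP[] := al02. Qed.

Let h (v : R) := v `^ (al - 1) / (1 + v ^+ 2).
Let c (n : nat) : R := (al + 2 * n%:R)^-1.
Let d (n : nat) : R := (2 * n.+1%:R - al)^-1.

Let d_gt0 n : 0 < 2 * n.+1%:R - al.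
Proof.
rewrite subr_gt0 (lt_le_trans al2)// -[leLHS]mulr1 ler_wpM2l//.
by rewrite ler1n.
Qed.

Let integrable_powR (D : set R) (p r : R) : measurable D ->
  (\int[mu]_(x in D) (x `^ p)%:E = r%:E)%E ->
  mu.-integrable D (EFin \o (fun x => x `^ p)).
Proof.
move=> mD E; apply/integrableP; split.
  by apply/measurable_EFinP/measurable_funTS; exact: measurable_powR.
under eq_integral do rewrite /= ger0_norm ?powR_ge0//.
by rewrite E ltry.
Qed.

Let integral01 n : (\int[mu]_(v in `]0%R, 1%R]) (v `^ (al - 1 + 2 * n%:R))%:E = (c n)%:E)%E.
Proof.
rewrite integral_powR_01; first by rewrite /c; congr (_^-1)%:E; ring.
by have : 0 <= 2 * n%:R :> R by []; move: al0; lra.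
Qed.

Let integral1y n : (\int[mu]_(v in `]1%R, +oo[) (v `^ (al - 3 - 2 * n%:R))%:E = (d n)%:E)%E.
Proof.
rewrite integral_itv_obnd_cbnd; last first.
  by apply/measurable_EFinP/measurable_funTS; exact: measurable_powR.
have n0 : 0 <= n%:R :> R by [].
rewrite integral_powR_1y; last by move: al2; lra.
rewrite /d -invrN; congr (_^-1)%:E; rewrite -[n.+1%:R]natr1; ring.
Qed.

Let pow01 n (v : R) : v \in `]0, 1]%classic ->
  v `^ (al - 1) * (v ^+ 2) ^+ n = v `^ (al - 1 + 2 * n%:R).
Proof.
rewrite inE /= in_itv/= => /andP[v0 _].
rewrite [RHS]powRD; last by apply/implyP => _; rewrite gt_eqF.
by rewrite -natrM powR_mulrn ?exprM ?(ltW v0).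
Qed.

Let pow1y n (v : R) : v \in `]1, +oo[%classic ->
  v `^ (al - 3) * (v ^- 2) ^+ n = v `^ (al - 3 - 2 * n%:R).
Proof.
rewrite inE /= in_itv/= andbT => v1; have v0 : 0 < v by rewrite (lt_trans _ v1).
rewrite [RHS]powRD; last by apply/implyP => _; rewrite gt_eqF.
by rewrite -natrM powR_invn ?(ltW v0)// exprVn exprM.
Qed.

Let part01 M : mu.-integrable `]0, 1] (EFin \o h) /\
  `|\int[mu]_(v in `]0, 1]) h v - \sum_(n < M) (-1) ^+ n * c n| <= c M.
Proof.
have E n : \int[mu]_(v in `]0, 1]) (v `^ (al - 1) * (v ^+ 2) ^+ n) = c n.
  rewrite (@eq_Rintegral _ _ _ mu `]0, 1] (fun v => v `^ (al - 1 + 2 * n%:R))).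
    by rewrite /Rintegral integral01.
  by move=> v; exact: pow01.
under eq_bigr do rewrite -E; rewrite -E.
apply: Rintegral_alternating_geometric => //.
- by apply: measurable_funTS; exact: measurable_powR.
- by move=> v _; exact: powR_ge0.
- move=> v; rewrite /= in_itv/= => /andP[v0 v1].
  by rewrite sqr_ge0/= expr_le1// ltW.
- move=> n; apply: eq_integrable (integrable_powR _ _ _ _ (integral01 n)) => // v vD /=.
  by rewrite pow01.
Qed.

Let part1y M : mu.-integrable `]1, +oo[ (EFin \o h) /\
  `|\int[mu]_(v in `]1, +oo[) h v - \sum_(n < M) (-1) ^+ n * d n| <= d M.
Proof.
have E n : \int[mu]_(v in `]1, +oo[) (v `^ (al - 3) * (v ^- 2) ^+ n) = d n.
  rewrite (@eq_Rintegral _ _ _ mu `]1, +oo[ (fun v => v `^ (al - 3 - 2 * n%:R))).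
    by rewrite /Rintegral integral1y.
  by move=> v; exact: pow1y.
have hE v : v \in `]1, +oo[%classic -> h v = v `^ (al - 3) / (1 + v ^- 2).
  rewrite inE /= in_itv/= andbT => v1; have v0 : 0 < v by rewrite (lt_trans _ v1).
  have -> : h v = (v `^ (al - 3) * v ^+ 2) / (1 + v ^+ 2).
    rewrite -[X in _ * X / _]powR_mulrn ?(ltW v0)// -powRD; last first.
      by apply/implyP => _; rewrite gt_eqF.
    by rewrite /h (_ : al - 3 + 2 = al - 1)//; ring.
  by field; rewrite !gt_eqF// ltr_wpDl ?sqr_ge0.
under eq_bigr do rewrite -E; rewrite -E.
rewrite (eq_Rintegral mu hE).
have [|||||i1 i2] := @Rintegral_alternating_geometric _ _ _ mu `]1, +oo[ (measurable_itv _)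
  (fun v => v `^ (al - 3)) (fun v => v ^- 2) M.
- by apply: measurable_funTS; exact: measurable_powR.
- by apply: measurable_fun_invr => // v _; exact: sqr_ge0.
- by move=> v _; exact: powR_ge0.
- move=> v; rewrite /= in_itv/= andbT => v1.
  have v0 : 0 < v by rewrite (lt_trans _ v1).
  by rewrite invr_ge0 sqr_ge0/= invf_le1 ?exprn_gt0// exprn_ege1// ltW.
- move=> n; apply: eq_integrable (integrable_powR _ _ _ _ (integral1y n)) => // v vD /=.
  by rewrite pow1y.
split=> //; apply: eq_integrable i1 => // v vD /=.
by rewrite hE.
Qed.

(** Truncated partial-fraction expansion of [pi / (2 sin (al pi / 2))]. There is one more [c] than
    [d] to match the Dirichlet kernel of order [N]: [c 0] belongs to its constant term, and the pair
    [c i.+1], [d i] to its term [cos (i.+1 x)]. *)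
Let partial_sum_h N := \sum_(n < N.+1) (-1) ^+ n * c n + \sum_(n < N) (-1) ^+ n * d n.

Lemma integrable_stieltjes_power : mu.-integrable `]0, +oo[
  (EFin \o (fun v => v `^ (al - 1) / (1 + v ^+ 2))).
Proof.
rewrite (_ : `]0, +oo[%classic = `]0, 1] `|` `]1, +oo[); last first.
  by rewrite -itv_bndbnd_setU// bnd_simp.
have mh : measurable_fun setT h.
  apply: measurable_funM; first exact: measurable_powR.
  by apply: measurable_fun_invr => [//|v _|]; [rewrite addr_ge0 ?sqr_ge0|exact: measurable_funD].
apply/integrableP; split; first exact/measurable_EFinP/measurable_funTS.
rewrite ge0_integral_setU//; last 2 first.
- by apply/measurable_funTS/measurableT_comp => //; exact/measurable_EFinP.
- by apply/disj_setPS => x [/=]; rewrite !in_itv/= => /andP[_ x1] /andP[]; rewrite ltNge x1.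
have /integrableP[_ H1] := (part01 0).1; have /integrableP[_ H2] := (part1y 0).1.
exact: lte_add_pinfty.
Qed.

Let cvg_dist (u e : nat -> R) (l : R) : (forall n, `|l - u n| <= e n) ->
  e n @[n --> \oo] --> (0 : R) -> u n @[n --> \oo] --> l.
Proof.
move=> ue e0; apply/cvgrPdist_le => r r0.
move/cvgrPdist_le : e0 => /(_ r r0); apply: filterS => n.
by rewrite sub0r normrN => en; rewrite (le_trans (ue n))// (le_trans (ler_norm _)).
Qed.

Let cvg_partial_sum_h : partial_sum_h N @[N --> \oo] --> \int[mu]_(v in `]0, +oo[) h v.
Proof.
have -> : \int[mu]_(v in `]0, +oo[) h v =
    \int[mu]_(v in `]0, 1]) h v + \int[mu]_(v in `]1, +oo[) h v.
  have E : `]0, +oo[%classic = `]0, 1] `|` `]1, +oo[ :> set R.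
    by rewrite -itv_bndbnd_setU// bnd_simp.
  rewrite E Rintegral_setU//; first by rewrite -E; exact: integrable_stieltjes_power.
  by apply/disj_setPS => x [/=]; rewrite !in_itv/= => /andP[_ x1] /andP[]; rewrite ltNge x1.
apply: cvgD.
  apply: (cvg_dist _ (fun n => c n.+1)); first by move=> n; exact: (part01 n.+1).2.
  apply: (@squeeze_cvgr _ _ _ _ (cst 0) (fun n => n.+1%:R^-1)).
  - near=> n; rewrite /c /= invr_ge0 addr_ge0 ?mulr_ge0 ?(ltW al0)//=.
    rewrite lef_pV2 ?posrE// ?addr_gt0// ?mulr_gt0//.
    by have : 0 <= n.+1%:R :> R by []; move: al0; lra.
  - exact: cvg_cst.
  - exact: cvg_harmonic.
apply: (cvg_dist _ d); first by move=> n; exact: (part1y n).2.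
apply: (@squeeze_cvgr _ _ _ _ (cst 0) (fun n => (2 - al)^-1 * n.+1%:R^-1)).
- near=> n; rewrite /d /= invr_ge0 (ltW (d_gt0 n))/= -invfM lef_pV2 ?posrE ?d_gt0//.
    have : 1 <= n.+1%:R :> R by rewrite ler1n.
    by move: (n.+1%:R : R) al0 => k; nra.
  by rewrite mulr_gt0// subr_gt0.
- exact: cvg_cst.
- by rewrite -(mulr0 (2 - al)^-1); apply: cvgM; [exact: cvg_cst|exact: cvg_harmonic].
Unshelve. all: by end_near. Qed.

(** * Evaluation through Dirichlet kernels and Cesaro means *)

Section dirichlet.
Let a := al / 2.

Let a_gt0 : 0 < a. Proof. by rewrite /a; move: al0; lra. Qed.
Let a_lt1 : a < 1. Proof. by rewrite /a; move: al2; lra. Qed.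

Let dirichlet N (x : R) : R := 2^-1 + \sum_(i < N) cos (i.+1%:R * x).

Let continuous_cosM (k : R) : continuous (fun x => cos (k * x)).
Proof. by apply: derivable_continuous => x; apply: ex_derive. Qed.

Let continuous_cosMM (k : R) : continuous (fun x => cos (a * x) * cos (k * x)).
Proof. by apply: derivable_continuous => x; apply: ex_derive. Qed.

Let cos_pin (n : nat) : cos (n%:R * pi) = (-1) ^+ n :> R.
Proof. by rewrite mulr_natl -[pi *+ n]add0r alternatingn ?cos0 ?mulr1//; exact: cosDpi. Qed.

Let sin_pin (n : nat) : sin (n%:R * pi) = 0 :> R.
Proof. by rewrite mulr_natl -[pi *+ n]add0r alternatingn ?sin0 ?mulr0//; exact: sinDpi. Qed.

(** Product-to-sum formulas leave [sin ((a + k) pi)] and [sin ((a - k) pi)], both equal to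
    [(-1)^k sin (a pi)]; their denominators [2 (a + k)] and [2 (a - k)] are those of [c] and, up to
    sign, of [d], since [al = 2 a]. *)
Let int_cos_dirichlet (i : nat) :
  \int[mu]_(x in `[0, pi]) (cos (a * x) * cos (i.+1%:R * x)) =
  sin (a * pi) * ((-1) ^+ i.+1 * c i.+1 + (-1) ^+ i * d i).
Proof.
have k1 : 1 <= i.+1%:R :> R by rewrite ler1n.
have := sin_pin i.+1; have := cos_pin i.+1; rewrite /c /d.
move: (i.+1%:R : R) k1 => k k1 ck sk.
have ak0 : a + k != 0 by rewrite gt_eqF//; move: a_gt0; lra.
have akm0 : a - k != 0 by rewrite lt_eqF//; move: a_lt1; lra.
have kma0 : k - a != 0 by rewrite gt_eqF//; move: a_lt1; lra.
pose F x := sin ((a + k) * x) / (2 * (a + k)) + sin ((a - k) * x) / (2 * (a - k)).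
have dF x : is_derive x (1 : R) F (cos (a * x) * cos (k * x)).
  apply: is_derive_eq; rewrite /GRing.scale/= mulrDl mulrBl cosD cosB; field.
  by rewrite akm0 ak0.
rewrite (FTC2_is_derive F _ _ _ (pi_ge0 R) dF) /F ?mulr0 ?sin0; last exact: continuous_cosMM.
rewrite !mul0r addr0 subr0 mulrDl mulrBl sinD sinB ck sk.
have -> : al = 2 * a by rewrite /a; field.
rewrite exprS; field.
by rewrite -mulrBr -mulrDr !mulf_neq0 ?kma0 ?akm0 ?ak0.
Qed.

Let int_dirichlet0 (i : nat) : \int[mu]_(x in `[0, pi]) cos (i.+1%:R * x) = 0.
Proof.
pose F x := sin (i.+1%:R * x) / i.+1%:R : R.
have k0 : i.+1%:R != 0 :> R by [].
have dF x : is_derive x (1 : R) F (cos (i.+1%:R * x)).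
  by apply: is_derive_eq; rewrite /GRing.scale/=; move: (i.+1%:R : R) k0 => y y0; field.
rewrite (FTC2_is_derive F _ _ _ (pi_ge0 R) dF) /F; last exact: continuous_cosM.
by rewrite sin_pin mulr0 sin0 subrr.
Qed.

Let continuous_dirichlet N : continuous (dirichlet N).
Proof.
elim: N => [|N IH] x.
  rewrite (_ : dirichlet 0 = cst 2^-1); first exact: cst_continuous.
  by apply/funext => y; rewrite /dirichlet big_ord0 addr0.
rewrite (_ : dirichlet N.+1 = fun y => dirichlet N y + cos (N.+1%:R * y)).
  by apply: cvgD; [exact: IH|exact: continuous_cosM].
by apply/funext => y; rewrite /dirichlet big_ord_recr/= addrA.
Qed.

Let u N := \int[mu]_(x in `[0, pi]) (cos (a * x) * dirichlet N x).

Let uE N : u N = sin (a * pi) * partial_sum_h N.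
Proof.
elim: N => [|N IH].
  rewrite /u /dirichlet; under eq_Rintegral do rewrite big_ord0 addr0.
  have a0 : a != 0 by rewrite gt_eqF.
  pose F x := sin (a * x) / (2 * a).
  have dF x : is_derive x (1 : R) F (cos (a * x) / 2).
    by apply: is_derive_eq; rewrite /GRing.scale/=; field.
  rewrite (FTC2_is_derive F _ _ _ (pi_ge0 R) dF) /F; last first.
    by apply: derivable_continuous => x; apply: ex_derive.
  rewrite mulr0 sin0 mul0r subr0 /partial_sum_h big_ord_recl !big_ord0 /c mulr0 !addr0.
  by rewrite expr0 mul1r /a; congr (_ * _^-1); field.
rewrite /u (eq_Rintegral mu (g := fun x => cos (a * x) * dirichlet N x +
    cos (a * x) * cos (N.+1%:R * x))); last first.
  by move=> x _; rewrite /dirichlet big_ord_recr/= addrA mulrDr.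
rewrite RintegralD//.
- rewrite -/(u N) IH int_cos_dirichlet /partial_sum_h.
  rewrite [in RHS]big_ord_recr [X in _ = _ * (_ + X)]big_ord_recr/=; ring.
- apply: integrable_continuous_itvcc => x; apply: cvgM; first exact: continuous_cosM.
  exact: continuous_dirichlet.
- by apply: integrable_continuous_itvcc; exact: continuous_cosMM.
Qed.

(** Each kernel multiplied by [2 (1 - cos x)] is a difference of consecutive cosines, so the sum
    telescopes. The multiplied form of the Fejer kernel avoids a division by zero at [x = 0]. *)
Let fejer M x : (\sum_(N < M) dirichlet N x) * (2 * (1 - cos x)) = 1 - cos (M%:R * x).
Proof.
have dE N : dirichlet N x * (2 * (1 - cos x)) = cos (N%:R * x) - cos (N.+1%:R * x).
  elim: N => [|N IH]; first by rewrite /dirichlet big_ord0 mul0r cos0 mul1r; field.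
  rewrite /dirichlet big_ord_recr/= addrA mulrDl -/(dirichlet N x) IH.
  have -> : N%:R * x = N.+1%:R * x - x by rewrite -[N.+1%:R]natr1; ring.
  have -> : N.+2%:R * x = N.+1%:R * x + x by rewrite -[N.+2%:R]natr1; ring.
  by rewrite cosB cosD; ring.
elim: M => [|M IH]; first by rewrite big_ord0 mul0r mul0r cos0 subrr.
by rewrite big_ord_recr/= mulrDl IH dE; ring.
Qed.

(** The quartic bound settles [x <= 2]. The constant 16 is set by the range [x > 2]: there
    [cos x <= 0], and [x < 4] because [pi / 2 < 2]. *)
Let one_sub_cos_ge (x : R) : 0 <= x <= pi -> x ^+ 2 / 16 <= 1 - cos x.
Proof.
move=> /andP[x0 xpi]; have pi2 := pihalf_lt2 R.
have [x2|x2] := leP x 2.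
  have := cos_le_quartic x; rewrite (_ : x ^+ 4 = x ^+ 2 * x ^+ 2); last by ring.
  have y0 := sqr_ge0 x; have : x ^+ 2 <= 4 by nra.
  by move: (x ^+ 2) y0 (cos x) => y y0 cx; nra.
have x4 : x ^+ 2 <= 16.
  by move: pi2 x2 x0 xpi; move: (pi : R) => p; nra.
suff : cos x <= 0 by lra.
rewrite -[x](subrK (pi / 2)) cosDpihalf oppr_le0 sin_ge0_pi//.
move: pi2 x2 x0 xpi (pi_ge0 R); move: (pi : R) => p *.
by apply/andP; split; lra.
Qed.

(** The factor [1 - cos (a x) <= x^2 / 2] cancels the singularity of the Fejer kernel at [0], which
    makes the bound uniform in [M]: [(x^2 / 2) * 2] divided by [2 * x^2 / 16] is 8. *)
Let fejer_le M x : 0 <= x <= pi ->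
  `|(cos (a * x) - 1) * \sum_(N < M) dirichlet N x| <= 8.
Proof.
move=> x0pi; have /andP[x0 xpi] := x0pi.
have [->|xn0] := eqVneq x 0; first by rewrite mulr0 cos0 subrr mul0r normr0.
have H1 := one_sub_cos_ge _ x0pi; have H2 := fejer M x.
have H3 := cos_ge_quadratic (a * x); have H4 := cos_le1 (a * x).
have H5 := cos_le1 (M%:R * x); have H6 := cos_geN1 (M%:R * x).
have xx : 0 < x ^+ 2 by rewrite exprn_even_gt0.
have c0 : 0 < 2 * (1 - cos x) by lra.
have aa : (a * x) ^+ 2 <= x ^+ 2.
  by rewrite exprMn ler_piMl ?sqr_ge0// expr_le1 ?(ltW a_gt0)// ltW.
have -> : \sum_(N < M) dirichlet N x = (1 - cos (M%:R * x)) / (2 * (1 - cos x)).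
  by rewrite -H2 mulfK// gt_eqF.
rewrite -normrN -mulNr opprB ger0_norm; last first.
  by rewrite mulr_ge0 ?subr_ge0// divr_ge0 ?subr_ge0// ltW.
rewrite mulrA ler_pdivrMr//; nra.
Qed.

Let int_dirichlet N : \int[mu]_(x in `[0, pi]) dirichlet N x = pi / 2.
Proof.
elim: N => [|N IH].
  rewrite /dirichlet; under eq_Rintegral do rewrite big_ord0 addr0.
  pose F x := x / 2 : R.
  have dF x : is_derive x (1 : R) F (2^-1).
    by apply: is_derive_eq; rewrite /GRing.scale/=; field.
  rewrite (FTC2_is_derive F _ _ _ (pi_ge0 R) dF) /F; last exact: cst_continuous.
  by rewrite mul0r subr0.
rewrite /dirichlet; under eq_Rintegral do rewrite big_ord_recr/= addrA.
rewrite RintegralD//; last 2 first.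
- by apply: integrable_continuous_itvcc; exact: continuous_dirichlet.
- by apply: integrable_continuous_itvcc; exact: continuous_cosM.
by rewrite int_dirichlet0// addr0.
Qed.

(** Replacing [cos (a x)] by its value 1 at [x = 0] costs at most 8 pointwise, hence [8 pi] in total
    whatever [M]; this is negligible after division by [M]. *)
Let mean_u M : `|\sum_(N < M) u N - M%:R * (pi / 2)| <= 8 * pi.
Proof.
have icM N : mu.-integrable `[0, pi] (EFin \o (fun x => cos (a * x) * dirichlet N x)).
  apply: integrable_continuous_itvcc => x; apply: cvgM; first exact: continuous_cosM.
  exact: continuous_dirichlet.
have iD N : mu.-integrable `[0, pi] (EFin \o dirichlet N).
  by apply: integrable_continuous_itvcc; exact: continuous_dirichlet.
have mpi : measurable (`[0, pi]%classic : set (measurableTypeR R)) by exact: measurable_itv.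
have -> : M%:R * (pi / 2) = \sum_(N < M) \int[mu]_(x in `[0, pi]) dirichlet N x.
  under eq_bigr do rewrite int_dirichlet.
  by rewrite sumr_const card_ord mulr_natl.
rewrite /u -(Rintegral_sum_ord mu _ mpi (fun N x => cos (a * x) * dirichlet N x))//.
rewrite -(Rintegral_sum_ord mu _ mpi dirichlet)//.
have i1 := integrable_sum_ord mu _ mpi _ M icM.
have i2 := integrable_sum_ord mu _ mpi _ M iD.
rewrite -RintegralB//.
have i3 : mu.-integrable `[0, pi] (EFin \o (fun x =>
    \sum_(N < M) cos (a * x) * dirichlet N x - \sum_(N < M) dirichlet N x)).
  by apply: eq_integrable (integrableB mpi i1 i2).
apply: (le_trans (le_normr_Rintegral mpi i3)).
apply: (@le_trans _ _ (\int[mu]_(x in `[0, pi]) 8)).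
  apply: le_Rintegral => //.
  - exact: integrable_norm.
  - by apply: integrable_continuous_itvcc; exact: cst_continuous.
  - move=> x; rewrite /= in_itv/= => x0pi.
    rewrite -mulr_sumr -[X in _ - X]mul1r -mulrBl; exact: fejer_le.
pose F x := 8 * x : R.
have dF x : is_derive x (1 : R) F 8.
  by apply: is_derive_eq; rewrite /GRing.scale/=; ring.
rewrite (FTC2_is_derive F _ _ _ (pi_ge0 R) dF) /F; last exact: cst_continuous.
by rewrite mulr0 subr0.
Qed.

(** The sequence [u] is known to converge, by its expression through [partial_sum_h], so its limit
    can be read off from its Cesaro means. Pointwise convergence of a Fourier series is thereby
    bypassed. *)
Lemma integral_stieltjes_power :
  \int[mu]_(v in `]0, +oo[) (v `^ (al - 1) / (1 + v ^+ 2)) = pi / (2 * sin (al * pi / 2)).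
Proof.
have s0 : 0 < sin (a * pi).
  apply: sin_gt0_pi; rewrite mulr_gt0 ?pi_gt0//=.
  by rewrite -[ltRHS]mul1r ltr_pM2r ?pi_gt0.
have cu : u N @[N --> \oo] --> sin (a * pi) * \int[mu]_(v in `]0, +oo[) h v.
  under eq_cvg do rewrite uE.
  by apply: cvgM; [exact: cvg_cst|exact: cvg_partial_sum_h].
have cm := cesaro cu.
have cm2 : arithmetic_mean u @ \oo --> pi / 2.
  apply: (cvg_dist _ (fun n => 8 * pi * n.+1%:R^-1)).
    move=> n; have n0 : 0 < n.+1%:R :> R by [].
    rewrite /arithmetic_mean/= seriesEord /=.
    have := mean_u n.+1; move: (\sum_(_ < _) _) n0 => s; move: (n.+1%:R : R) => k k0 H.
    have -> : pi / 2 - k^-1 * s = - (s - k * (pi / 2)) / k by field; rewrite gt_eqF.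
    by rewrite normrM normrN normfV (gtr0_norm k0) ler_wpM2r// invr_ge0 ltW.
  by rewrite -(mulr0 (8 * pi)); apply: cvgM; [exact: cvg_cst|exact: cvg_harmonic].
have H := cvg_unique _ cm cm2.
have -> : al * pi / 2 = a * pi by rewrite /a; field.
have {}H : sin (a * pi) * \int[mu]_(v in `]0, +oo[) h v = pi / 2 by exact: H.
have sn0 : sin (a * pi) != 0 by rewrite gt_eqF.
rewrite -[LHS](mulKf sn0) -[Rintegral _ _ _]/(\int[mu]_(v in `]0, +oo[) h v) H.
by field.
Qed.

End dirichlet.

End stieltjes_power_integral.

(** * The series of [(1 - cos (k theta)) / k^(al+1)] *)

Section poisson_series.
Context {R : realType}.
Implicit Types (q theta : R).

(** Closed form of the sum over [k >= 1] of [q^k (1 - cos (k theta))]. The second factor of the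
    denominator is [|1 - q exp (i theta)|^2]; with [1 - cos theta] factored out, the sign and the
    size for small [theta] are visible. *)
Definition poisson_sum q theta : R :=
  (1 - cos theta) * (q * (1 + q)) /
  ((1 - q) * ((1 - q) ^+ 2 + 2 * q * (1 - cos theta))).

Let one_sub_cos_ge0 theta : 0 <= 1 - cos theta.
Proof. by rewrite subr_ge0 cos_le1. Qed.

Let denom_gt0 q theta : 0 < q < 1 -> 0 < (1 - q) ^+ 2 + 2 * q * (1 - cos theta).
Proof.
move=> /andP[q0 q1]; rewrite ltr_wpDr ?exprn_gt0 ?subr_gt0//.
by rewrite !mulr_ge0 ?one_sub_cos_ge0// ltW.
Qed.

Let partial_sumE q theta n : 0 < q < 1 ->
  \sum_(i < n) q ^+ i.+1 * (1 - cos (theta * i.+1%:R)) = poisson_sum q theta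
  - q ^+ n.+1 / (1 - q) + (q ^+ n.+1 * cos (theta * n.+1%:R) -
     q ^+ 2 * (q ^+ n * cos (theta * n%:R))) / ((1 - q) ^+ 2 + 2 * q * (1 - cos theta)).
Proof.
move=> q01; have /andP[q0 q1] := q01.
have d0 : (1 - q) ^+ 2 + 2 * q * (1 - cos theta) != 0 by rewrite gt_eqF ?denom_gt0.
have q10 : 1 - q != 0 by rewrite gt_eqF ?subr_gt0.
elim: n => [|n IH].
  rewrite big_ord0 mulr0 cos0 !mulr1 /poisson_sum; field.
  by rewrite q10 d0.
rewrite big_ord_recr/= IH.
have -> : theta * n%:R = theta * n.+1%:R - theta.
  by rewrite -natr1 mulrDr mulr1 addrK.
have -> : theta * n.+2%:R = theta * n.+1%:R + theta.
  by rewrite -[n.+2%:R]natr1 mulrDr mulr1.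
rewrite cosB cosD !exprS /poisson_sum; field.
by rewrite q10 d0.
Qed.

Lemma poisson_series q theta : 0 < q < 1 ->
  (\sum_(i <oo) (q ^+ i.+1 * (1 - cos (theta * i.+1%:R)))%:E = (poisson_sum q theta)%:E)%E.
Proof.
move=> q01; have /andP[q0 q1] := q01.
have q_to0 : q ^+ n @[n --> \oo] --> (0 : R).
  by apply: cvg_expr; rewrite gtr0_norm.
apply/cvg_lim => //.
under eq_cvg do rewrite sumEFin big_mkord partial_sumE//.
apply: cvg_EFin; first exact: nearW.
have q_cos0 : q ^+ n * cos (theta * n%:R) @[n --> \oo] --> (0 : R).
  apply/norm_cvg0P; apply: (@squeeze_cvgr _ _ _ _ (cst 0) (fun n => q ^+ n)) => //.
    near=> n; rewrite /= normr_ge0/= normrM ger0_norm ?exprn_ge0 ?(ltW q0)//.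
    by rewrite ler_piMr ?exprn_ge0 ?(ltW q0)// cos_max.
  exact: cvg_cst.
have q_toS : q ^+ n.+1 @[n --> \oo] --> (0 : R) by rewrite cvg_shiftS.
have q_cosS : q ^+ n.+1 * cos (theta * n.+1%:R) @[n --> \oo] --> (0 : R).
  by rewrite (cvg_shiftS (fun n => q ^+ n * cos (theta * n%:R))).
set P := poisson_sum q theta; set Delta := (1 - q) ^+ 2 + _.
rewrite [X in _ --> X](_ : P = P - 0 / (1 - q) + (0 - q ^+ 2 * 0) / Delta); last first.
  by rewrite mulr0 subrr !mul0r subr0 addr0.
apply: cvgD.
  by apply: cvgB; [exact: cvg_cst|apply: cvgM; [exact: q_toS|exact: cvg_cst]].
apply: cvgM; last exact: cvg_cst.
by apply: cvgB => //; apply: cvgM; [exact: cvg_cst|exact: q_cos0].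
Unshelve. all: by end_near. Qed.

Lemma poisson_sum_ge0 q theta : 0 < q < 1 -> 0 <= poisson_sum q theta.
Proof.
move=> q01; have /andP[q0 q1] := q01.
have d0 := denom_gt0 _ theta q01; have w0 := one_sub_cos_ge0 theta.
have q10 : 0 < 1 - q by rewrite subr_gt0.
by apply: divr_ge0; apply: mulr_ge0; rewrite ?w0 ?(ltW d0) ?(ltW q10)// mulr_ge0 ?addr_ge0// ltW.
Qed.

Let poisson_sum_le1 q theta : 0 < q < 1 -> poisson_sum q theta <= 2 * (q / (1 - q)).
Proof.
move=> q01; have /andP[q0 q1] := q01; have d0 := denom_gt0 _ theta q01.
rewrite /poisson_sum ler_pdivrMr ?mulr_gt0 ?subr_gt0//.
have -> : 2 * (q / (1 - q)) * ((1 - q) * ((1 - q) ^+ 2 + 2 * q * (1 - cos theta))) =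
   q * (2 * ((1 - q) ^+ 2 + 2 * q * (1 - cos theta))).
  by field; rewrite gt_eqF ?subr_gt0.
rewrite mulrCA ler_pM2l//.
have := one_sub_cos_ge0 theta; have : 1 - cos theta <= 2 by have := cos_geN1 theta; lra.
move: (1 - cos theta) => w w2 w0.
have [q3|q3] := leP (1 - 3 * q) 0; nra.
Qed.

Let poisson_sum_le2 s theta : 0 < s -> poisson_sum (expR (- s)) theta <= 7 * theta ^+ 2 / s ^+ 3.
Proof.
(* With [q = e^-s] and [D = e^s - 1], [q (1 + q) / (1 - q)^3 = D^-1 + 3 D^-2 + 2 D^-3]. *)
move=> s0; pose D := expR s - 1.
have D1 : s <= D by have := expR_ge1Dx s; rewrite /D; lra.
have D2 : s ^+ 2 / 2 <= D.
  have E2 : 1 + s ^+ 2 / 2 <= expR s by exact: (@expR_ge1Dxn R s 1 (ltW s0)).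
  by rewrite /D; lra.
have D3 : s ^+ 3 / 6 <= D.
  have E3 : 1 + s ^+ 3 / 6 <= expR s by exact: (@expR_ge1Dxn R s 2 (ltW s0)).
  by rewrite /D; lra.
have D0 : 0 < D by lra.
have qE : expR (- s) = (1 + D)^-1 by rewrite expRN /D addrC subrK.
rewrite qE.
have w0 := one_sub_cos_ge0 theta; have w2 := cos_ge_quadratic theta.
apply: (@le_trans _ _ ((1 - cos theta) * (D^-1 + 3 * D ^- 2 + 2 * D ^- 3))).
  rewrite /poisson_sum.
  have -> : (1 - cos theta) * (D^-1 + 3 * D ^- 2 + 2 * D ^- 3) =
      (1 - cos theta) * ((1 + D)^-1 * (1 + (1 + D)^-1)) /
      ((1 - (1 + D)^-1) * (1 - (1 + D)^-1) ^+ 2).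
    field; rewrite !gt_eqF// ; lra.
  have q1 : 0 < 1 - (1 + D)^-1 by rewrite subr_gt0 invf_lt1; lra.
  have q0 : 0 < (1 + D)^-1 by rewrite invr_gt0; lra.
  move: ((1 + D)^-1) q0 q1 => q q0 q1.
  have q20 : 0 < (1 - q) ^+ 2 by rewrite exprn_gt0.
  have qw : 0 <= 2 * q * (1 - cos theta) by rewrite !mulr_ge0// ltW.
  apply: ler_wpM2l; first by rewrite mulr_ge0// mulr_ge0 ?addr_ge0// ltW.
  have dn : 0 < (1 - q) ^+ 2 + 2 * q * (1 - cos theta) by rewrite ltr_wpDr.
  rewrite lef_pV2 ?posrE ?(mulr_gt0 q1 q20) ?(mulr_gt0 q1 dn)//.
  by rewrite ler_wpM2l ?(ltW q1)// lerDl.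
have s3 : 0 < s ^+ 3 by rewrite exprn_gt0.
(* All three powers of [1 / D] are brought to [1 / s^3], using [D >= s^3 / 6], [D^2 >= s * s^2 / 2]
   and [D^3 >= s^3]. Together with [1 - cos theta <= theta^2 / 2] this gives
   [(6 + 3 * 2 + 2) / 2 = 7]. *)
have B1 : D^-1 <= 6 / s ^+ 3.
  by rewrite ler_pdivlMr// ler_pdivrMl//; lra.
have B2 : D ^- 2 <= 2 / s ^+ 3.
  rewrite ler_pdivlMr// ler_pdivrMl ?exprn_gt0//.
  have := ler_pM (ltW s0) (divr_ge0 (sqr_ge0 s) (ler0n _ 2)) D1 D2.
  by rewrite -expr2 mulrA -exprS ler_pdivrMr// mulrC => H; rewrite mulrC.
have B3 : D ^- 3 <= s ^- 3.
  by rewrite lef_pV2 ?posrE ?exprn_gt0// ler_pXn2r ?nnegrE ?(ltW s0) ?(ltW D0).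
have -> : 7 * theta ^+ 2 / s ^+ 3 = theta ^+ 2 / 2 * (6 / s ^+ 3 + 3 * (2 / s ^+ 3) + 2 * s ^- 3).
  by field; rewrite gt_eqF.
apply: ler_pM => //; last by lra.
- by rewrite !addr_ge0 ?mulr_ge0 ?invr_ge0 ?exprn_ge0// ltW.
- by lra.
Qed.

(* [poisson_sum_le1] and [poisson_sum_le2] give the bounds [2 / v] and [7 / v^3]. *)
Lemma poisson_sum_le v theta : 0 < v -> 0 < theta ->
  theta * poisson_sum (expR (- (theta * v))) theta <= 9 / (v * (1 + v ^+ 2)).
Proof.
move=> v0 t0; have s0 : 0 < theta * v by rewrite mulr_gt0.
have q01 : 0 < expR (- (theta * v)) < 1 by rewrite expR_gt0 expR_lt1 oppr_lt0.
have H1 := poisson_sum_le1 _ theta q01; have H2 := poisson_sum_le2 _ theta s0.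
have qle : expR (- (theta * v)) / (1 - expR (- (theta * v))) <= (theta * v)^-1.
  have /andP[q0 q1] := q01.
  rewrite ler_pdivrMr ?subr_gt0// ler_pdivlMl//.
  have := expR_ge1Dx (theta * v); have := expRxMexpNx_1 (theta * v).
  move: (expR _) (expR (- _)) q0 => E q q0; nra.
have H1' : theta * poisson_sum (expR (- (theta * v))) theta * v <= 2.
  have -> : 2 = theta * (2 * (theta * v)^-1) * v :> R.
    by field; rewrite !gt_eqF.
  rewrite ler_wpM2r ?(ltW v0)// ler_wpM2l ?(ltW t0)// (le_trans H1)//.
  by rewrite ler_wpM2l.
have H2' : theta * poisson_sum (expR (- (theta * v))) theta * v ^+ 3 <= 7.
  have -> : 7 = theta * (7 * theta ^+ 2 / (theta * v) ^+ 3) * v ^+ 3 :> R.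
    by field; rewrite !gt_eqF.
  by rewrite ler_wpM2r ?exprn_ge0 ?(ltW v0)// ler_wpM2l ?(ltW t0).
rewrite ler_pdivlMr ?mulr_gt0// ?ltr_wpDr ?sqr_ge0//.
by move: (theta * _) H1' H2' => X; nra.
Qed.

(** Once the powers of [theta] are distributed, the expression is a rational function of
    [(1 - cos theta) / theta^2], [(1 - q) / theta] and [q], which tend to [1/2], [v] and [1]. *)
Lemma cvg_poisson_sum (theta_ : nat -> R) v : 0 < v -> (forall n, 0 < theta_ n) ->
  theta_ n @[n --> \oo] --> (0 : R) ->
  theta_ n * poisson_sum (expR (- (theta_ n * v))) (theta_ n) @[n --> \oo] -->
  (v * (1 + v ^+ 2))^-1.
Proof.
move=> v0 t0 tc.
pose q n := expR (- (theta_ n * v)).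
pose x n := (1 - cos (theta_ n)) / theta_ n ^+ 2.
pose y n := (1 - q n) / theta_ n.
have tv0 : theta_ n * v @[n --> \oo] --> (0 : R).
  by rewrite -(mul0r v); apply: cvgM; [exact: tc|exact: cvg_cst].
have qc : q n @[n --> \oo] --> (1 : R).
  rewrite -[X in _ --> X](@expR0 R) -oppr0.
  apply: (@continuous_cvg _ _ _ _ _ _ expR); first exact: continuous_expR.
  exact: cvgN.
have xc : x n @[n --> \oo] --> (2^-1 : R).
  apply: (@squeeze_cvgr _ _ _ _ (fun n => 2^-1 - theta_ n ^+ 2 / 24) (cst 2^-1)).
  - near=> n; have := t0 n; rewrite /x /=; move: (theta_ n) => z z0.
    have z2 : 0 < z ^+ 2 by rewrite exprn_gt0.
    rewrite ler_pdivlMr// ler_pdivrMr//.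
    have := cos_ge_quadratic z; have := cos_le_quartic z.
    have -> : z ^+ 4 = z ^+ 2 * z ^+ 2 by ring.
    by move: (z ^+ 2) (cos z) => a b *; apply/andP; split; lra.
  - rewrite -[X in _ --> X]subr0 -(mul0r 24^-1); apply: cvgB; first exact: cvg_cst.
    apply: cvgM; last exact: cvg_cst.
    by rewrite -(mul0r 0); apply: cvgM.
  - exact: cvg_cst.
have yc : y n @[n --> \oo] --> v.
  apply: (@squeeze_cvgr _ _ _ _ (fun n => v / (1 + theta_ n * v)) (cst v)).
  - near=> n; have := t0 n; rewrite /y /q /=; move: (theta_ n) => z z0.
    rewrite ler_pdivlMr// ler_pdivrMr//.
    have zv : 0 < z * v by rewrite mulr_gt0.
    have := expR_ge1Dx (- (z * v)); have := expR_ge1Dx (z * v).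
    have := expRxMexpNx_1 (z * v); have := expR_gt0 (- (z * v)).
    move: (expR _) (expR (- _)) => E p p0 Ep E1 p1.
    rewrite mulrAC ler_pdivrMr; last lra.
    by apply/andP; split; nra.
  - rewrite -[X in _ --> X]divr1 -[X in _ / X]addr0; apply: cvgM; first exact: cvg_cst.
    apply: cvgV; first by rewrite addr0.
    by apply: cvgD; [exact: cvg_cst|exact: tv0].
  - exact: cvg_cst.
have E n : theta_ n * poisson_sum (q n) (theta_ n) =
    x n * (q n * (1 + q n)) / (y n * (y n ^+ 2 + 2 * q n * x n)).
  have q01 : 0 < q n < 1 by rewrite expR_gt0 expR_lt1 oppr_lt0 mulr_gt0.
  have := denom_gt0 _ (theta_ n) q01; have /andP[q0 q1] := q01.
  rewrite /poisson_sum /x /y; move: (cos (theta_ n)) => c.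
  move: (q n) q1 => p p1; move: (theta_ n) (t0 n) => z z0 d0.
  by field; rewrite !gt_eqF ?subr_gt0.
under eq_cvg do rewrite E.
have -> : (v * (1 + v ^+ 2))^-1 = 2^-1 * (1 * (1 + 1)) / (v * (v ^+ 2 + 2 * 1 * 2^-1)).
  by field; rewrite !gt_eqF// ltr_wpDl ?sqr_ge0.
apply: cvgM.
  apply: cvgM; first exact: xc.
  by apply: cvgM => //; apply: cvgD => //; exact: cvg_cst.
apply: cvgV; first by rewrite mulr1 divff// mulf_neq0 ?gt_eqF// ltr_wpDl ?sqr_ge0.
apply: cvgM => //; apply: cvgD; first by apply: cvgM.
by apply: cvgM => //; apply: cvgM => //; exact: cvg_cst.
Unshelve. all: by end_near. Qed.

End poisson_series.

(** * The power series as a Gamma integral *)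

Section power_series_asymptotics.
Context {R : realType}.
Notation mu := (@lebesgue_measure R).
Variable al : R.
Hypothesis al02 : 0 < al < 2.

Let al0 : 0 < al. Proof. by have /andP[] := al02. Qed.
Let al2 : al < 2. Proof. by have /andP[] := al02. Qed.

Let G (x : R) := x `^ al * expR (- x).

Let G_ge0 x : 0 <= G x. Proof. by rewrite mulr_ge0 ?powR_ge0 ?expR_ge0. Qed.

Let mG : measurable_fun setT G.
Proof.
by apply: measurable_funM; [exact: measurable_powR|exact: measurableT_comp].
Qed.

Let GammaE : Gamma (al + 1) = \int[mu]_(x in `]0, +oo[) G x.
Proof. by rewrite /Gamma addrK. Qed.

(** With [y = x^2], [x^al <= 1 + y] and [exp x >= 1 + y^2 / 24]; the constant comes from [(1 + y)^2
    <= 2 + 2 y^2 <= 48 (1 + y^2 / 24)]. *)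
Let G_le x : 0 <= x -> G x <= 48 * (oneDsqr x)^-1.
Proof.
move=> x0; rewrite /oneDsqr ler_pdivlMr ?ltr_wpDr ?sqr_ge0//.
have p2 : x `^ al <= 1 + x ^+ 2.
  have [x1|x1] := leP x 1.
    rewrite (@le_trans _ _ 1) ?lerDl ?sqr_ge0//.
    have : x `^ al <= 1 `^ al by rewrite ge0_ler_powR ?nnegrE// ltW.
    by rewrite powR1.
  rewrite (@le_trans _ _ (x ^+ 2)) ?lerDr//.
  by rewrite -powR_mulrn// ler_powR// ltW.
have e4 : 1 + x ^+ 4 / 24 <= expR x by exact: (@expR_ge1Dxn R x 3 x0).
have eN : expR x * expR (- x) = 1 by exact: expRxMexpNx_1.
rewrite /G -mulrA [expR _ * _]mulrC mulrA -ler_pdivlMr ?expR_gt0// expRN invrK.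
apply: (@le_trans _ _ ((1 + x ^+ 2) * (1 + x ^+ 2))).
  by rewrite ler_wpM2r// addr_ge0 ?sqr_ge0.
move: e4; have -> : x ^+ 4 = x ^+ 2 * x ^+ 2 by ring.
move: (x ^+ 2) (sqr_ge0 x) (expR x) => y y0 E.
have := sqr_ge0 (y - 1); rewrite expr2; nra.
Qed.

Let integrable_G : mu.-integrable `]0, +oo[ (EFin \o G).
Proof.
have i1 : mu.-integrable `[0, +oo[ (EFin \o (fun x : R => 48 * (oneDsqr x)^-1)).
  rewrite (_ : _ \o _ = fun x => (48 : R)%:E * ((oneDsqr x)^-1)%:E)%E//.
  apply: integrableZl => //; apply/integrableP; split.
    apply/measurable_EFinP/measurable_funTS.
    by apply: continuous_measurable_fun; exact: continuous_oneDsqrV.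
  under eq_integral do rewrite /= ger0_norm ?invr_ge0//.
  by rewrite integral0y_oneDsqr ltry.
have i2 : mu.-integrable `]0, +oo[ (EFin \o (fun x : R => 48 * (oneDsqr x)^-1)).
  by apply: integrableS i1 => // x; rewrite /= !in_itv/= !andbT => /ltW.
apply: integrable_le i2 => //; first exact: measurable_funTS.
by move=> x; rewrite /= in_itv/= andbT => x0; rewrite ger0_norm// G_le// ltW.
Qed.

Let Gamma_EFin : (\int[mu]_(x in `]0%R, +oo[) (G x)%:E = (Gamma (al + 1))%:E)%E.
Proof.
by rewrite GammaE /Rintegral fineK//; apply: integrable_fin_num.
Qed.

Let measurable_expRNM r : measurable_fun setT (fun v : R => expR (- (r * v))).
Proof.
apply: continuous_measurable_fun.
by apply: (@derivable_continuous _ (fun v => expR (- (r * v)))) => x; apply: ex_derive.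
Qed.

Let powR_continuous0 : x `^ al @[x --> (0 : R)^'+] --> (0 : R) `^ al.
Proof. by rewrite powR0 ?gt_eqF//; exact: powR_cvg0. Qed.

Lemma Gamma_scale r : 0 < r ->
  (\int[mu]_(v in `]0%R, +oo[) (v `^ al * expR (- (r * v)))%:E =
   (Gamma (al + 1) * r `^ (- (al + 1)))%:E)%E.
Proof.
move=> r0.
have cG : {within `[(0 : R), +oo[, continuous G}.
  apply/continuous_within_itvcyP; split.
    move=> x; rewrite in_itv/= andbT => x0; apply: cvgM.
      exact: continuous_powR_gt0.
    apply: (@continuous_comp _ _ _ (fun x => - x) expR); last exact: continuous_expR.
    exact: continuousN.
  apply: cvgM; first exact: powR_continuous0.
  apply: cvg_at_right_filter.
  apply: (@continuous_comp _ _ _ (fun x => - x) expR); last exact: continuous_expR.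
  exact: continuousN.
have dF : (fun x : R => r * x)^`()%classic = cst r.
  apply/funext => x; rewrite derive1E.
  have : is_derive x (1 : R) (fun x => r * x) r.
    by apply: is_derive_eq; rewrite /GRing.scale/=; ring.
  by move=> [_ ->].
have H := @increasing_ge0_integration_by_substitutiony R (fun x => r * x) G 0.
rewrite mulr0 dF in H.
have {}H : (\int[mu]_(x in `[0%R, +oo[) (G x)%:E =
    \int[mu]_(x in `[0%R, +oo[) (G (r * x) * r)%:E)%E.
  apply: H => //.
  - by move=> x y _ _ xy; rewrite ltr_pM2l.
  - by move=> x _; exact: cst_continuous.
  - exact: is_cvg_cst.
  - exact: is_cvg_cst.
  - split.
      by move=> x _; apply: ex_derive.
    by apply: cvg_at_right_filter; apply: cvgM; [exact: cvg_cst|exact: cvg_id].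
  - exact: gt0_cvgMry.
have ob (f : R -> R) : measurable_fun setT f ->
    (\int[mu]_(x in `]0%R, +oo[) (f x)%:E = \int[mu]_(x in `[0%R, +oo[) (f x)%:E)%E.
  by move=> mf; rewrite integral_itv_obnd_cbnd//; exact/measurable_EFinP/measurable_funTS.
have mf : measurable_fun setT (fun v : R => v `^ al * expR (- (r * v))).
  by apply: measurable_funM; [exact: measurable_powR|exact: measurable_expRNM].
rewrite ob// EFinM -Gamma_EFin ob// H.
have -> : (\int[mu]_(x in `[0%R, +oo[) (G (r * x) * r)%:E = (r `^ (al + 1))%:E *
    \int[mu]_(x in `[0%R, +oo[) (x `^ al * expR (- (r * x)))%:E)%E.
  rewrite -ge0_integralZl_EFin//; last 3 first.
  - by move=> v _; rewrite lee_fin mulr_ge0 ?powR_ge0 ?expR_ge0.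
  - exact/measurable_EFinP/measurable_funTS.
  - exact: powR_ge0.
  apply: eq_integral => v; rewrite inE/= in_itv/= andbT => v0.
  rewrite /G -EFinM powRM ?(ltW r0)// powRD ?powRr1 ?(ltW r0)//; last first.
    by apply/implyP => _; rewrite gt_eqF.
  by congr EFin; ring.
rewrite muleC muleA -EFinM powRN mulVf ?mul1e//.
by rewrite gt_eqF// powR_gt0.
Qed.

(** Integrand of the Gamma representation after rescaling the variable by [theta], normalised so
    that it tends to [v^(al - 1) / (1 + v^2)] as [theta] tends to [0]. *)
Definition power_kernel (theta v : R) : R :=
  v `^ al * (theta * poisson_sum (expR (- (theta * v))) theta).

Let q01 (theta v : R) : 0 < theta -> 0 < v -> 0 < expR (- (theta * v)) < 1.
Proof. by move=> t0 v0; rewrite expR_gt0 expR_lt1 oppr_lt0 mulr_gt0. Qed.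

Let power_kernel_ge0 (theta v : R) : 0 < theta -> 0 < v -> 0 <= power_kernel theta v.
Proof.
move=> t0 v0; apply: mulr_ge0; rewrite ?powR_ge0//; apply: mulr_ge0; rewrite ?(ltW t0)//.
by apply: poisson_sum_ge0; exact: q01.
Qed.

Let measurable_power_kernel (theta : R) : 0 < theta ->
  measurable_fun (`]0, +oo[%classic : set R) (power_kernel theta).
Proof.
move=> t0; apply: measurable_funM; first by apply: measurable_funTS; exact: measurable_powR.
apply: measurable_funM => //.
have mq : measurable_fun (`]0, +oo[%classic : set R) (fun v : R => expR (- (theta * v))).
  by apply: measurable_funTS; exact: measurable_expRNM.
rewrite /poisson_sum; apply: measurable_funM.
  by apply: measurable_funM => //; apply: measurable_funM => //; exact: measurable_funD.
apply: measurable_fun_invr => //.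
  move=> v; rewrite /= in_itv/= andbT => v0.
  have /andP[q0 q1] := q01 _ _ t0 v0.
  apply: mulr_ge0; first by rewrite subr_ge0 ltW.
  by rewrite addr_ge0 ?sqr_ge0// !mulr_ge0 ?(ltW q0)// subr_ge0 cos_le1.
apply: measurable_funM; first exact: measurable_funB.
apply: measurable_funD; last by apply: measurable_funM => //; exact: measurable_funM.
by apply: measurable_funX; exact: measurable_funB.
Qed.

(** A multiple of the pointwise limit of the kernels, so its integrability is that of the limit. The
    factor 9 is the one of [poisson_sum_le]. *)
Let dominant (v : R) : R := 9 * (v `^ (al - 1) / (1 + v ^+ 2)).

Let power_kernel_le (theta v : R) : 0 < theta -> 0 < v -> power_kernel theta v <= dominant v.
Proof.
move=> t0 v0; rewrite /power_kernel /dominant.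
have -> : 9 * (v `^ (al - 1) / (1 + v ^+ 2)) = v `^ al * (9 / (v * (1 + v ^+ 2))).
  rewrite -(mulr_powRB1 (ltW v0) al0); field.
  by rewrite !gt_eqF// ltr_wpDr ?sqr_ge0.
by rewrite ler_wpM2l ?powR_ge0// poisson_sum_le.
Qed.

Let integrable_dominant : mu.-integrable `]0, +oo[ (EFin \o dominant).
Proof.
rewrite (_ : _ \o _ = fun v => (9 : R)%:E * (v `^ (al - 1) / (1 + v ^+ 2))%:E)%E//.
by apply: integrableZl => //; exact: integrable_stieltjes_power.
Qed.

Let integrable_power_kernel (theta : R) : 0 < theta ->
  mu.-integrable `]0, +oo[ (EFin \o power_kernel theta).
Proof.
move=> t0; apply: integrable_le integrable_dominant => //.
  exact: measurable_power_kernel.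
move=> v; rewrite /= in_itv/= andbT => v0.
by rewrite ger0_norm ?power_kernel_ge0// power_kernel_le.
Qed.

Definition power_transform (theta : R) : R := \int[mu]_(v in `]0, +oo[) power_kernel theta v.

(* Expand each power of k as a Gamma integral and sum the series under the integral. *)
Lemma Gamma_power_series (theta : R) : 0 < theta ->
  (\sum_(i <oo) (Gamma (al + 1) * i.+1%:R `^ (- (al + 1)) *
     (1 - cos (theta * i.+1%:R)))%:E =
   (theta `^ al * power_transform theta)%:E)%E.
Proof.
move=> t0.
have cos_ge0 (x : R) : 0 <= 1 - cos x by rewrite subr_ge0 cos_le1.
pose f (i : nat) (v : R) : R :=
  v `^ al * expR (- (theta * i.+1%:R * v)) * (1 - cos (theta * i.+1%:R)).
have mf i : measurable_fun setT (fun v : R => v `^ al * expR (- (theta * i.+1%:R * v))).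
  by apply: measurable_funM; [exact: measurable_powR|exact: measurable_expRNM].
have f_ge0 i v : 0 <= f i v by rewrite !mulr_ge0 ?powR_ge0 ?expR_ge0.
(* [Gamma_scale] is used at rate [theta * i.+1], not [i.+1]: the variable is then already rescaled,
   and the exponentials are the powers of [exp (- theta v)]. *)
have E1 i : (Gamma (al + 1) * i.+1%:R `^ (- (al + 1)) * (1 - cos (theta * i.+1%:R)))%:E =
    ((theta `^ (al + 1))%:E * \int[mu]_(v in `]0%R, +oo[) (f i v)%:E)%E.
  under eq_integral do rewrite EFinM muleC.
  rewrite ge0_integralZl_EFin//; last 2 first.
  - by move=> v _; rewrite lee_fin mulr_ge0 ?powR_ge0 ?expR_ge0.
  - by apply/measurable_EFinP/measurable_funTS; exact: mf.
  rewrite Gamma_scale ?mulr_gt0// -!EFinM; congr EFin.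
  rewrite (powRM _ (ltW t0))// [theta `^ (- _)]powRN.
  by field; rewrite gt_eqF// powR_gt0.
under eq_eseriesr do rewrite E1.
rewrite nneseriesZl; last by move=> i _; apply: integral_ge0 => v _; rewrite lee_fin.
rewrite -integral_nneseries//; last 2 first.
- move=> i; apply/measurable_EFinP/measurable_funTS/measurable_funM => //.
  exact: mf.
- by move=> i v _; rewrite lee_fin.
have E2 v : v \in `]0%R, +oo[%classic -> (\sum_(i <oo) (f i v)%:E =
    (theta^-1)%:E * (power_kernel theta v)%:E)%E.
  rewrite inE/= in_itv/= andbT => v0.
  have q := q01 _ _ t0 v0.
  rewrite (eq_eseriesr (g := fun i => ((v `^ al)%:E * (expR (- (theta * v)) ^+ i.+1 *
      (1 - cos (theta * i.+1%:R)))%:E)%E)); last first.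
    move=> i _; rewrite -EFinM /f -mulrA; congr (_ * (_ * _))%:E.
    by rewrite -expRM_natl; congr expR; ring.
  rewrite nneseriesZl; last first.
    by move=> i _; rewrite lee_fin mulr_ge0 ?exprn_ge0 ?expR_ge0.
  rewrite poisson_series// -!EFinM /power_kernel; congr EFin.
  by field; rewrite gt_eqF.
have -> : (\int[mu]_(v in `]0%R, +oo[) (\sum_(i <oo) (f i v)%:E) =
    \int[mu]_(v in `]0%R, +oo[) ((theta^-1)%:E * (power_kernel theta v)%:E))%E.
  exact: eq_integral.
rewrite ge0_integralZl_EFin//; last 3 first.
- by move=> v; rewrite /= in_itv/= andbT => v0; rewrite lee_fin power_kernel_ge0.
- by apply/measurable_EFinP; exact: measurable_power_kernel.
- by rewrite invr_ge0 ltW.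
have -> : (\int[mu]_(v in `]0%R, +oo[) (power_kernel theta v)%:E =
    (power_transform theta)%:E)%E.
  rewrite /power_transform /Rintegral fineK//; apply: integrable_fin_num => //.
  exact: integrable_power_kernel.
rewrite -!EFinM; congr EFin; rewrite mulrA; congr (_ * _).
rewrite powRD; last by apply/implyP => _; rewrite gt_eqF.
by rewrite powRr1 ?(ltW t0)// mulfK// gt_eqF.
Qed.

Lemma cvg_power_transform (theta_ : nat -> R) : (forall n, 0 < theta_ n) ->
  theta_ n @[n --> \oo] --> (0 : R) ->
  power_transform (theta_ n) @[n --> \oo] --> pi / (2 * sin (al * pi / 2)).
Proof.
move=> t0 tc; rewrite -integral_stieltjes_power//.
apply: (Rdominated_convergence mu _ (fun n => power_kernel (theta_ n)) _ dominant) => //.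
- by move=> n; exact: measurable_power_kernel.
- move=> v; rewrite /= in_itv/= andbT => v0.
  have -> : v `^ (al - 1) / (1 + v ^+ 2) = v `^ al * (v * (1 + v ^+ 2))^-1.
    rewrite -(mulr_powRB1 (ltW v0) al0); field.
    by rewrite !gt_eqF// ltr_wpDr ?sqr_ge0.
  by apply: cvgM; [exact: cvg_cst|exact: cvg_poisson_sum].
- move=> n v; rewrite /= in_itv/= andbT => v0.
  by rewrite ger0_norm ?power_kernel_ge0// power_kernel_le.
Qed.

End power_series_asymptotics.

(** * Convergence of the random walk *)

Section poisson_limit.
Context {R : realType}.

(** The inequality [1 + x <= exp x], at [- a] and at [a / (1 - a)], encloses [1 - a] between
    [exp (- a / (1 - a))] and [exp (- a)]; raising to the power [n] gives two sequences with the
    same limit. *)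
Lemma cvg_one_sub_pow (a : nat -> R) (A : R) :
  (\forall n \near \oo, 0 <= a n) -> a n @[n --> \oo] --> (0 : R) ->
  n%:R * a n @[n --> \oo] --> A -> (1 - a n) ^+ n @[n --> \oo] --> expR (- A).
Proof.
move=> a_ge0 a0 aA.
apply: (@squeeze_cvgr _ _ _ _ (fun n => expR (- (n%:R * a n / (1 - a n))))
    (fun n => expR (- (n%:R * a n)))).
- near=> n.
  have an0 : 0 <= a n by near: n.
  have an1 : a n < 1.
    suff : a n < 1 by [].
    by near: n; apply: (cvgr_lt (0 : R)) => //; exact: ltr01.
  have a1 : 0 < 1 - a n by rewrite subr_gt0.
  have -> : expR (- (n%:R * a n / (1 - a n))) = expR (- (a n / (1 - a n))) ^+ n.
    by rewrite -expRM_natl; congr expR; ring.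
  have -> : expR (- (n%:R * a n)) = expR (- a n) ^+ n.
    by rewrite -expRM_natl; congr expR; ring.
  apply/andP; split; rewrite lerXn2r ?nnegrE ?expR_ge0 ?(ltW a1)//.
    rewrite expRN -[leRHS]invrK lef_pV2 ?posrE ?expR_gt0 ?invr_gt0//.
    rewrite [leLHS](_ : _ = 1 + a n / (1 - a n)); first exact: expR_ge1Dx.
    by field; rewrite gt_eqF.
  exact: expR_ge1Dx.
- apply: (@continuous_cvg _ _ _ _ _ _ expR); first exact: continuous_expR.
  apply: cvgN; rewrite -[X in _ --> X]divr1 -[X in _ / X]subr0; apply: cvgM => //.
  by apply: cvgV; [rewrite subr0|apply: cvgB => //; exact: cvg_cst].
- apply: (@continuous_cvg _ _ _ _ _ _ expR); first exact: continuous_expR.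
  exact: cvgN.
Unshelve. all: by end_near. Qed.

End poisson_limit.

(** * The characteristic function of the stable law *)

Section stable_characteristic_function.
Context {R : realType}.
Notation mu := (@lebesgue_measure R).
Variables (al t : R).
Hypotheses (al0 : 0 < al) (t0 : 0 < t).

Let psi (k : R) := expR (- (t * `|k| `^ al)).

Lemma integrable_oneDsqrV : mu.-integrable setT (EFin \o (fun k : R => (oneDsqr k)^-1)).
Proof.
have c1 : continuous (fun k : R => (oneDsqr k)^-1) by exact: continuous_oneDsqrV.
apply/integrableP; split.
  by apply/measurable_EFinP; exact: continuous_measurable_fun.
under eq_integral do rewrite /= ger0_norm ?invr_ge0//.
rewrite ge0_symfun_integralT//; last first.
  by move=> k; rewrite /oneDsqr /= sqrrN.
by rewrite -set_itvcy integral0y_oneDsqr -EFinM ltry.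
Qed.

Lemma measurable_stable_cf : measurable_fun setT psi.
Proof.
apply: measurableT_comp => //; apply: measurableT_comp => //.
apply: measurable_funM => //.
by apply: (@measurableT_comp _ _ _ _ _ _ (fun y : R => y `^ al)) => //.
Qed.

(** One term [u^m / m!] of the exponential series, with [al * m >= 2], already gives decay like
    [1 / k^2], whatever [al > 0]. *)
Lemma integrable_stable_cf : mu.-integrable setT (EFin \o psi).
Proof.
pose m := (Num.Def.trunc (2 / al)).+1.
have m2 : 2 <= al * m%:R.
  by rewrite mulrC -ler_pdivrMr//; exact/ltW/truncnS_gt.
(* The summand 2 serves [|k| <= 1], where [1 + k^2 <= 2]; the other serves [|k| > 1], where
   [1 + k^2 <= 2 k^2] and [k^2] is at most [m! / t^m] times the exponential. *)
pose K := 2 + 2 * (m`!%:R / t ^+ m).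
have K0 : 0 <= m`!%:R / t ^+ m by rewrite divr_ge0 ?exprn_ge0// ltW.
have iK : mu.-integrable setT (EFin \o (fun k : R => K * (oneDsqr k)^-1)).
  rewrite (_ : _ \o _ = fun x => K%:E * ((oneDsqr x)^-1)%:E)%E//.
  by apply: integrableZl => //; exact: integrable_oneDsqrV.
apply: integrable_le iK => //; first exact: measurable_stable_cf.
move=> k _; rewrite ger0_norm ?expR_ge0//.
have d0 : 0 < oneDsqr k by [].
rewrite ler_pdivlMr// /psi.
have [k1|k1] := leP `|k| 1.
  have : oneDsqr k <= 2.
    by rewrite /oneDsqr -real_normK ?num_real// -[leRHS]/(1 + 1) lerD2l expr_le1.
  have : expR (- (t * `|k| `^ al)) <= 1.
    by rewrite -expR0 ler_expR oppr_le0 mulr_ge0 ?powR_ge0// ltW.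
  have := expR_ge0 (- (t * `|k| `^ al)); move: K0 d0; rewrite /K.
  by move: (expR _) (oneDsqr _) (_ / _) => x y z *; nra.
have kk : 1 <= k ^+ 2 by rewrite -real_normK ?num_real// exprn_ege1// ltW.
pose u := t * `|k| `^ al.
have u0 : 0 <= u by rewrite mulr_ge0 ?powR_ge0// ltW.
have um : t ^+ m * k ^+ 2 <= u ^+ m.
  rewrite /u exprMn ler_wpM2l ?exprn_ge0 ?(ltW t0)//.
  rewrite -real_normK ?num_real// -powR_mulrn ?normr_ge0// -powR_mulrn ?powR_ge0//.
  by rewrite -powRrM ler_powR// ltW.
have E : u ^+ m / m`!%:R <= expR u.
  by have := @expR_ge1Dxn R u m.-1 u0; rewrite -/m /=; lra.
rewrite -/u expRN ler_pdivrMl ?expR_gt0//.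
have m0 : 0 < m`!%:R :> R by rewrite ltr0n fact_gt0.
have tm0 : 0 < t ^+ m by rewrite exprn_gt0.
have kE : k ^+ 2 <= m`!%:R / t ^+ m * expR u.
  rewrite mulrAC ler_pdivlMr// mulrC (le_trans um)//.
  by rewrite mulrC -ler_pdivrMr.
have := expR_ge0 u; rewrite /oneDsqr /K.
move: K0 kk kE; move: (expR u) (_ / _) (k ^+ 2) => E0 z y *; nra.
Qed.

Lemma stable_densityE y :
  2 * pi * stable_density al t y = \int[mu]_k (psi k * cos (k * y)).
Proof.
rewrite /stable_density /g_stable /Cintegral /= mul0r subr0 mulrA divff ?mul1r; last first.
  by rewrite mulf_neq0// gt_eqF// pi_gt0.
by apply: eq_Rintegral => k _; rewrite mulr0 subr0 cosN mulrC.
Qed.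

End stable_characteristic_function.

(** * Reduction of the theorem to one step *)

Section walk_convergence.
Context {R : realType} {d} {T : measurableType d} {P : probability T R}.
Context {d'} {T' : measurableType d'} {P' : probability T' R}.
Variables (Y : nat -> {RV P >-> int}) (S : {RV P' >-> R}) (h : nat -> R).
Variables (al t : R) (p : int -> R).
Hypotheses (al0 : 0 < al) (t0 : 0 < t) (indepY : mutually_independent Y).
Hypothesis S_density : has_density S (stable_density al t).
Hypothesis pY : forall m k, P (Y m @^-1` [set k]) = (p k)%:E.
Hypothesis p_sym : forall k, p (- k) = p k.

Let step_cf_le1 theta : 0 <= 1 - step_cf Y theta.
Proof.
rewrite subr_ge0 /step_cf.
have E1 : \int[P]_w 1 = 1 :> R.
  by rewrite Rintegral_cst// [X in 1 * fine X](_ : _ = 1%E) ?mulr1//; exact: probability_setT.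
rewrite -[leRHS]E1; apply: le_Rintegral => //.
- apply: (integrable_bounded P _ 1) => [|w]; last exact: cos_max.
  exact: (measurableT_comp (f := fun k : int => cos (theta * k%:~R))).
- by apply: (integrable_bounded P (cst 1) 1) => // w; rewrite normr1.
Qed.

Let step_cf_norm kappa n : step_cf Y (kappa * h n) = step_cf Y (`|kappa| * h n).
Proof.
have [k0|k0] := leP 0 kappa; first by rewrite ger0_norm.
rewrite ltr0_norm// mulNr /step_cf; apply: eq_Rintegral => w _.
by rewrite mulNr cosN.
Qed.

Lemma walk_converges : (forall kappa : R, 0 < kappa ->
    n%:R * (1 - step_cf Y (kappa * h n)) @[n --> \oo] --> t * kappa `^ al) ->
  converges_in_distribution (walk_RV Y h) S.
Proof.
move=> H x _.
have walkE n w : walk_RV Y h n w = h n * (partial_sum Y n w)%:~R.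
  by rewrite /walk_RV/= /walk /partial_sum rmorph_sum.
have cf n k := expectation_cos_sin_partial_sum Y p pY p_sym indepY (k * h n) n.
apply: (cvg_cdf (walk_RV Y h) S (fun n k => step_cf Y (k * h n) ^+ n)
  (fun k => expR (- (t * `|k| `^ al))) (stable_density al t)) => //.
- move=> n k; rewrite -(cf n k).1; apply: eq_Rintegral => w _.
  by rewrite walkE mulrA.
- move=> n k; rewrite -[RHS](cf n k).2; apply: eq_Rintegral => w _.
  by rewrite walkE mulrA.
- move=> k; under eq_cvg do rewrite step_cf_norm.
  have [->|k0] := eqVneq k 0.
    rewrite normr0 powR0 ?gt_eqF// mulr0 oppr0 expR0.
    have -> : (fun n => step_cf Y (0 * h n) ^+ n) = cst 1.
      apply/funext => n; rewrite mul0r /step_cf.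
      under eq_Rintegral do rewrite mul0r cos0.
      by rewrite Rintegral_cst// [X in 1 * fine X](_ : _ = 1%E) ?mulr1 ?expr1n//; exact: probability_setT.
    exact: cvg_cst.
  have k1 : 0 < `|k| by rewrite normr_gt0.
  have := H _ k1; set a := fun n => _ * (1 - _) => aA.
  have -> : (fun n => step_cf Y (`|k| * h n) ^+ n) =
      (fun n => (1 - (1 - step_cf Y (`|k| * h n))) ^+ n).
    by apply/funext => n; rewrite subKr.
  apply: cvg_one_sub_pow => //; first exact: nearW.
  (* That [1 - step_cf] itself tends to [0] follows from the convergence of [n] times it, after
     division by [n]. *)
  have inv0 : n%:R^-1 @[n --> \oo] --> (0 : R).
    by rewrite -cvg_shiftS; exact: cvg_harmonic.
  apply: (@cvg_trans _ ((n%:R^-1 * a n) @[n --> \oo])).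
    apply: near_eq_cvg; near=> n; rewrite /a mulKf// pnatr_eq0 -lt0n.
    by near: n; exact: nbhs_infty_gt.
  by rewrite -(mul0r (t * `|k| `^ al)); exact: cvgM.
- exact: integrable_stable_cf.
- by move=> y; exact: stable_densityE.
Unshelve. all: by end_near. Qed.

End walk_convergence.

(** * Behaviour of one step in the two cases *)

Section step_asymptotics.
Context {R : realType} {d} {T : measurableType d} {P : probability T R}.
Variables (Y : nat -> {RV P >-> int}) (h : nat -> R) (t : R).
Hypothesis h_to0 : h n @[n --> \oo] --> (0 : R).

Lemma step_prob_lt2_sym (al m : R) k : step_prob_lt2 al m (- k) = step_prob_lt2 al m k.
Proof. by rewrite /step_prob_lt2 oppr_eq0 normrN. Qed.

Lemma step_prob_eq2_sym (la : R) k : step_prob_eq2 la (- k) = step_prob_eq2 la k.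
Proof. by rewrite /step_prob_eq2 oppr_eq0 normrN. Qed.

Lemma step_asymptotics_lt2 (al m : R) : 0 < al < 2 ->
  (forall i k, P (Y i @^-1` [set k]) = (step_prob_lt2 al m k)%:E) ->
  (\forall n \near \oo, 0 < h n /\ scaling_lt2 al m (h n) = t / n%:R) ->
  forall kappa : R, 0 < kappa ->
    n%:R * (1 - step_cf Y (kappa * h n)) @[n --> \oo] --> t * kappa `^ al.
Proof.
move=> al02 pY [N _ hN] kappa k0.
have /andP[al0 al2] := al02.
set s := sin (al * pi / 2).
have s0 : 0 < s.
  apply: sin_gt0_pi; rewrite divr_gt0 ?mulr_gt0 ?pi_gt0//=.
  by rewrite ltr_pdivrMr// mulrC ltr_pM2l ?pi_gt0.
have cfE theta : 0 < theta ->
    1 - step_cf Y theta = 2 * m * pi^-1 * s * (theta `^ al * power_transform al theta).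
  move=> th0; apply: EFin_inj.
  rewrite (step_cf_series Y _ pY (step_prob_lt2_sym al m)) EFinM -Gamma_power_series// -nneseriesZl; last first.
    move=> i _; rewrite lee_fin !mulr_ge0 ?powR_ge0 ?subr_ge0 ?cos_le1//.
    by apply: Rintegral_ge0 => x _; rewrite mulr_ge0 ?powR_ge0 ?expR_ge0.
  apply: eq_eseriesr => i _; rewrite -EFinM; congr EFin.
  by rewrite /step_prob_lt2 /b_coef -/s /=; ring.
(* The shift makes [h] positive at every index, as [cvg_power_transform] demands, and excludes
   [n = 0], where [t / n] is [0] by convention. *)
rewrite -(cvg_shiftn (maxn N 1)).
pose theta n := kappa * h (n + maxn N 1).
have th0 n : 0 < theta n.
  rewrite mulr_gt0//; have [] // := hN (n + maxn N 1)%N.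
  by rewrite /= (leq_trans _ (leq_addl _ _))// leq_maxl.
have thc : theta n @[n --> \oo] --> (0 : R).
  rewrite -(mulr0 kappa); apply: cvgM; first exact: cvg_cst.
  by rewrite (cvg_shiftn (maxn N 1)).
have E n : (n + maxn N 1)%:R * (1 - step_cf Y (theta n)) =
    t * kappa `^ al * (2 * pi^-1 * s) * power_transform al (theta n).
  have n0 : (n + maxn N 1)%:R != 0 :> R.
    by rewrite pnatr_eq0 -lt0n addn_gt0 leq_max orbT orbT.
  have [|hn0] := hN (n + maxn N 1)%N.
    by rewrite /= (leq_trans _ (leq_addl _ _))// leq_maxl.
  rewrite /scaling_lt2 => hE.
  rewrite cfE// {1}/theta powRM ?(ltW k0) ?(ltW hn0)//.
  have -> : t = (n + maxn N 1)%:R * (m * h (n + maxn N 1)%N `^ al).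
    by rewrite hE mulrC divfK.
  ring.
pose A := t * kappa `^ al * (2 * pi^-1 * s).
have AE : t * kappa `^ al = A * (pi / (2 * s)).
  have cancel (x q r : R) : 0 < q -> 0 < r -> x = x * (2 * q^-1 * r) * (q / (2 * r)).
    by move=> q0 r0; field; rewrite !gt_eqF.
  by apply: cancel => //; exact: pi_gt0.
apply: (@cvg_trans _ ((A * power_transform al (theta n)) @[n --> \oo])).
  by apply: near_eq_cvg; apply: nearW => n; rewrite /A /= -E.
rewrite AE.
by apply: cvgM; [exact: cvg_cst|exact: cvg_power_transform].
Qed.

Lemma step_asymptotics_eq2 (la : R) : 0 < la ->
  (forall i k, P (Y i @^-1` [set k]) = (step_prob_eq2 la k)%:E) ->
  (\forall n \near \oo, 0 < h n /\ h n < 1 /\ scaling_eq2 la (h n) = t / n%:R) ->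
  forall kappa : R, 0 < kappa ->
    n%:R * (1 - step_cf Y (kappa * h n)) @[n --> \oo] --> t * kappa `^ 2.
Proof.
move=> la0 pY hP kappa k0.
have cfE theta : ((1 - step_cf Y theta) / (2 * la))%:E =
    (\sum_(i <oo) (cubic_term theta i)%:E)%E.
  rewrite mulrC EFinM (step_cf_series Y _ pY (step_prob_eq2_sym la)) -nneseriesZl; last first.
    by move=> i _; rewrite lee_fin /step_prob_eq2/= !mulr_ge0 ?subr_ge0 ?cos_le1 ?(ltW la0)//.
  apply: eq_eseriesr => i _; rewrite -EFinM; congr EFin.
  rewrite /step_prob_eq2 /cubic_term /=.
  set u := (X in _ * (2 * (_ * X) * _) = _); set v := 1 - cos _.
  by rewrite !mulrA -[(2 * la)^-1 * 2 * la]mulrA mulVf ?mul1r// mulf_neq0// gt_eqF.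
have th_to0 : kappa * h n @[n --> \oo] --> (0 : R).
  by rewrite -(mulr0 kappa); apply: cvgM => //; exact: cvg_cst.
have lnV0 : (ln (h n)^-1)^-1 @[n --> \oo] --> (0 : R).
  apply/cvgrPdist_lt => e e0; near=> n.
  have [hn0 [hn1 _]] : 0 < h n /\ h n < 1 /\ scaling_eq2 la (h n) = t / n%:R by near: n.
  have hne : h n < expR (- e^-1).
    by near: n; apply: (cvgr_lt (0 : R)) => //; exact: expR_gt0.
  have ln0 : e^-1 < ln (h n)^-1.
    by rewrite lnV ?posrE// ltrNr -[ltRHS]expRK ltr_ln ?posrE ?expR_gt0.
  have lnp : 0 < ln (h n)^-1 by rewrite (lt_trans _ ln0)// invr_gt0.
  by rewrite sub0r normrN gtr0_norm ?invr_gt0// -[ltRHS]invrK ltf_pV2 ?posrE ?invr_gt0.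
rewrite (_ : kappa `^ 2 = kappa ^+ 2); last by rewrite -powR_mulrn// ltW.
apply/cvgrPdist_le => e e0.
(* The 18 is twice the constant 9 of [cubic_series_asymptotics], and [ln kappa] comes from splitting
   [ln (1 / (kappa h))]. Both errors carry the factor [n * la * h^2], which the scaling turns into
   [t / ln (1 / h)]. *)
have bound : `|t| * kappa ^+ 2 * (18 + `|ln kappa|) * (ln (h n)^-1)^-1 @[n --> \oo] --> (0 : R).
  rewrite -(mulr0 (`|t| * kappa ^+ 2 * (18 + `|ln kappa|))).
  by apply: cvgM => //; exact: cvg_cst.
near=> n.
have [hn0 [hn1 hE]] : 0 < h n /\ h n < 1 /\ scaling_eq2 la (h n) = t / n%:R by near: n.
have th1 : kappa * h n <= 1.
  by near: n; apply: (cvgr_le (0 : R)) => //; exact: ltr01.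
have th0 : 0 < kappa * h n by rewrite mulr_gt0.
have n0 : n%:R != 0 :> R.
  by rewrite pnatr_eq0 -lt0n; near: n; exact: nbhs_infty_gt.
have l0 : 0 < ln (h n)^-1 by rewrite ln_gt0// invf_gt1.
have be : `|t| * kappa ^+ 2 * (18 + `|ln kappa|) * (ln (h n)^-1)^-1 <= e.
  near: n; exact: (cvgr_le (0 : R)).
apply: le_trans be.
have := cubic_series_asymptotics (kappa * h n) _ _ (cfE _).
rewrite th0 th1 => /(_ isT).
have -> : ln (kappa * h n)^-1 = ln (h n)^-1 - ln kappa.
  by rewrite invfM mulrC ln_div ?posrE ?invr_gt0.
move: hE; rewrite /scaling_eq2.
have q_ge0 : 0 <= n%:R :> R by exact: ler0n.
move: (1 - step_cf _ _) => D.
move: (h n) hn0 l0 n0 {th1 th0 hn1} => x x0.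
move: (ln x^-1) (n%:R : R) q_ge0 => l q q_ge0 l0 q0 hE H.
have tE : t = q * (la * x ^+ 2 * l) by rewrite hE mulrC divfK.
have -> : t * kappa ^+ 2 - q * D = - (2 * la * q * (D / (2 * la) -
   (kappa * x) ^+ 2 / 2 * (l - ln kappa))) + t * kappa ^+ 2 * ln kappa / l.
  by rewrite tE; field; rewrite !gt_eqF.
have t_ge0 : 0 <= t by rewrite tE !mulr_ge0 ?exprn_ge0 ?(ltW la0) ?(ltW x0) ?(ltW l0).
rewrite (ger0_norm t_ge0) (le_trans (ler_normD _ _))// normrN.
rewrite (normrM (2 * la * q)) (normrM _ l^-1) (ger0_norm (x := 2 * la * q)) ?mulr_ge0 ?(ltW la0)//.
rewrite (mulrDr _ 18) mulrDl; apply: lerD.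
  apply: (le_trans (ler_wpM2l _ H)); first by rewrite !mulr_ge0 ?(ltW la0).
  rewrite le_eqVlt; apply/orP; left; apply/eqP.
  by rewrite tE; field; rewrite gt_eqF.
by rewrite normfV (ger0_norm (ltW l0)) normrM ger0_norm ?mulr_ge0 ?exprn_ge0 ?(ltW k0)// mulrA.
Unshelve. all: by end_near. Qed.

End step_asymptotics.

Theorem theorem5p1 (R : realType) (alpha t : R)
    (d : measure_display) (T : measurableType d) (P : probability T R)
    (Y : nat -> {RV P >-> int})
    (d' : measure_display) (T' : measurableType d') (P' : probability T' R)
    (S : {RV P' >-> R}) (h : nat -> R) :
  0 < alpha <= 2 -> 0 < t ->
  mutually_independent Y ->
  has_density S (stable_density alpha t) ->
  h n @[n --> \oo] --> 0 ->
  (alpha < 2 -> forall mu : R,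
    0 < mu <= 1 / (2 * b_coef alpha * zeta (alpha + 1)) ->
    (forall (m : nat) (k : int),
       P (Y m @^-1` [set k]) = (step_prob_lt2 alpha mu k)%:E) ->
    (\forall n \near \oo, 0 < h n /\ scaling_lt2 alpha mu (h n) = t / n%:R) ->
    converges_in_distribution (walk_RV Y h) S) /\
  (alpha = 2 -> forall lambda : R,
    0 < lambda <= 1 / (2 * zeta 3) ->
    (forall (m : nat) (k : int),
       P (Y m @^-1` [set k]) = (step_prob_eq2 lambda k)%:E) ->
    (\forall n \near \oo,
       0 < h n /\ h n < 1 /\ scaling_eq2 lambda (h n) = t / n%:R) ->
    converges_in_distribution (walk_RV Y h) S).
Proof.
move=> /andP[al0 _] t0 indepY S_density h0; split => [al2 mu _ pY hP|alE la /andP[la0 _] pY hP].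
  apply: (walk_converges Y S h alpha t _ al0 t0 indepY S_density pY).
    exact: step_prob_lt2_sym.
  by apply: step_asymptotics_lt2 pY hP => //; rewrite al0.
apply: (walk_converges Y S h alpha t _ al0 t0 indepY S_density pY).
  exact: step_prob_eq2_sym.
by rewrite alE; exact: step_asymptotics_eq2 pY hP.
Qed.
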